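(* Let $k$ be an algebraically closed field of characteristic zero and let $A$ be a nonpositively cohomologically graded augmented dga over $k$. The following are equivalent: (i) $A$ is good; that is, $A$ is quasi-isomorphic to $\varprojlim\mathcal{A}$ for some pro-Artinian dga $\mathcal{A}$, and $A$ is cohomologically locally finite. (ii) $A$ is cohomologically locally finite and $H^0(A)$ is local.
   Context: A dga is a differential graded $k$-algebra with cohomological grading. An augmented dga is Artinian local if it has finite total dimension over $k$ and its augmentation ideal is nilpotent. Let $\mathrm{dgArt}_k^{\le0}$ be the category of Artinian local dgas concentrated in nonpositive degrees. A pro-Artinian dga is an object of the pro-category $\mathrm{pro}(\mathrm{dgArt}_k^{\le0})$, i.e. a formal cofiltered limit of objects of $\mathrm{dgArt}_k^{\le0}$; $\varprojlim$ sends it to its actual limit in nonpositive augmented dgas. Cohomologically locally finite means each $H^j(A)$ is finite-dimensional over $k$. *)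

(* Defs.v *)
From HB Require Import structures.
From Stdlib Require Import Relation_Operators.
From mathcomp Require Import all_boot all_order all_algebra.
From mathcomp Require Import generic_quotient.
From mathcomp Require Import boolp.

Set Implicit Arguments.
Unset Strict Implicit.
Unset Printing Implicit Defensive.

Import GRing.Theory Num.Theory.
Local Open Scope ring_scope.
Local Open Scope quotient_scope.

(* Differential graded algebras over k: unital, associative, not assumed      *)
(* graded-commutative, Z-graded with a differential of degree +1.  The target *)
(* degree of a product or differential is a separate index constrained by an  *)
(* equation, so that the axioms compare elements of one and the same          *)
(* component and no transport along equations between degrees is needed.      *)
Record dga (k : fieldType) := Dga {
  gr :> int -> lmodType k;
  dmul : forall i j n : int, i + j = n -> gr i -> gr j -> gr n;
  dunit : gr 0;
  dd : forall i j : int, i + 1 = j -> {linear gr i -> gr j};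
  dmul_linl : forall i j n (e : i + j = n) (y : gr j),
    linear (fun x : gr i => dmul e x y);
  dmul_linr : forall i j n (e : i + j = n) (x : gr i),
    linear (fun y : gr j => dmul e x y);
  dmulA : forall i j l ij jl n (e1 : j + l = jl) (e2 : i + jl = n)
      (e3 : i + j = ij) (e4 : ij + l = n) (x : gr i) (y : gr j) (z : gr l),
    dmul e2 x (dmul e1 y z) = dmul e4 (dmul e3 x y) z;
  dmul1l : forall i (e : 0 + i = i) (x : gr i), dmul e dunit x = x;
  dmul1r : forall i (e : i + 0 = i) (x : gr i), dmul e x dunit = x;
  ddd : forall i j l (e1 : i + 1 = j) (e2 : j + 1 = l) (x : gr i),
    dd e2 (dd e1 x) = 0;
  dleibniz : forall i j n i' j' n' (e : i + j = n) (en : n + 1 = n')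
      (ei : i + 1 = i') (e1 : i' + j = n') (ej : j + 1 = j')
      (e2 : i + j' = n') (x : gr i) (y : gr j),
    dd en (dmul e x y) =
      dmul e1 (dd ei x) y + (-1) ^+ `|i|%N *: dmul e2 x (dd ej y)
}.

(* The family [aug] is a morphism of dgas to k, the latter being concentrated *)
(* in degree 0 with zero differential.                                        *)
Record augDga (k : fieldType) := AugDga {
  dga_of :> dga k;
  aug : forall i : int, {scalar dga_of i};
  aug_deg : forall i (x : dga_of i), i != 0 -> aug i x = 0;
  aug1 : aug 0 (dunit dga_of) = 1;
  augM : forall i j n (e : i + j = n) (x : dga_of i) (y : dga_of j),
    aug n (dmul e x y) = aug i x * aug j y;
  augd : forall i j (e : i + 1 = j) (x : dga_of i), aug j (dd dga_of e x) = 0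
}.

Record npDga (k : fieldType) := NpDga {
  augDga_of :> augDga k;
  nonpos : forall i : int, 0 < i -> forall x : augDga_of i, x = 0
}.

Record dgaHom (k : fieldType) (A B : npDga k) := DgaHom {
  hom_fun :> forall i : int, {linear A i -> B i};
  hom1 : hom_fun 0 (dunit A) = dunit B;
  homM : forall i j n (e : i + j = n) (x : A i) (y : A j),
    hom_fun n (dmul e x y) = dmul e (hom_fun i x) (hom_fun j y);
  homd : forall i j (e : i + 1 = j) (x : A i),
    hom_fun j (dd A e x) = dd B e (hom_fun i x);
  hom_aug : forall i (x : A i), aug B i (hom_fun i x) = aug A i x
}.

Section LmodQuot.
Variables (k : fieldType) (V : lmodType k) (S : submodClosed V).

Definition lq_equiv (x y : V) := x - y \in S.

Let memN x : (- x \in S) = (x \in S).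
Proof.
by apply/idP/idP=> /(rpredZ (-1)); rewrite !scaleN1r ?opprK.
Qed.

Lemma lq_equiv_is_equiv : equiv_class_of lq_equiv.
Proof.
split=> [x | x y | y x z]; rewrite /lq_equiv ?subrr ?rpred0 //.
  by rewrite -opprB memN.
by move=> xy yz; rewrite -(subrKA y) rpredD.
Qed.

Canonical lq_equiv_equiv := EquivRelPack lq_equiv_is_equiv.
Canonical lq_equiv_encModRel := defaultEncModRel lq_equiv.

Definition lquot := {eq_quot lq_equiv}.
HB.instance Definition _ : EqQuotient V lq_equiv lquot := EqQuotient.on lquot.
HB.instance Definition _ := Choice.on lquot.

Lemma lquotP (x y : V) : \pi_lquot x = \pi_lquot y <-> x - y \in S.
Proof. by split=> [/eqmodP | h]; [|apply/eqmodP]. Qed.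

Definition lq_zero : lquot := lift_cst lquot 0.
Definition lq_add := lift_op2 lquot +%R.
Definition lq_opp := lift_op1 lquot -%R.
Definition lq_scale (a : k) := lift_op1 lquot ( *:%R a).

Canonical lq_pi_zero_morph := PiConst lq_zero.

Lemma lq_pi_opp : {morph \pi : x / - x >-> lq_opp x}.
Proof.
move=> x; unlock lq_opp; apply/eqmodP.
by rewrite /= /lq_equiv -opprD memN; apply/lquotP; rewrite reprK.
Qed.
Canonical lq_pi_opp_morph := PiMorph1 lq_pi_opp.

Lemma lq_pi_add : {morph \pi : x y / x + y >-> lq_add x y}.
Proof.
move=> x y; unlock lq_add; apply/eqmodP.
by rewrite /= /lq_equiv opprD addrACA rpredD //; apply/lquotP; rewrite reprK.
Qed.
Canonical lq_pi_add_morph := PiMorph2 lq_pi_add.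

Lemma lq_pi_scale a : {morph \pi : x / a *: x >-> lq_scale a x}.
Proof.
move=> x; unlock lq_scale; apply/eqmodP.
by rewrite /= /lq_equiv -scalerBr rpredZ //; apply/lquotP; rewrite reprK.
Qed.
Canonical lq_pi_scale_morph a := PiMorph1 (lq_pi_scale a).

Lemma lq_addA : associative lq_add.
Proof. by move=> x y z; rewrite -[x]reprK -[y]reprK -[z]reprK !piE addrA. Qed.
Lemma lq_addC : commutative lq_add.
Proof. by move=> x y; rewrite -[x]reprK -[y]reprK !piE addrC. Qed.
Lemma lq_add0 : left_id lq_zero lq_add.
Proof. by move=> x; rewrite -[x]reprK !piE add0r. Qed.
Lemma lq_addN : left_inverse lq_zero lq_opp lq_add.
Proof. by move=> x; rewrite -[x]reprK !piE addNr. Qed.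
HB.instance Definition _ :=
  GRing.isZmodule.Build lquot lq_addA lq_addC lq_add0 lq_addN.

Lemma lq_scaleA a b (v : lquot) :
  lq_scale a (lq_scale b v) = lq_scale (a * b) v.
Proof. by rewrite -[v]reprK !piE scalerA. Qed.
Lemma lq_scale1 : left_id 1 lq_scale.
Proof. by move=> v; rewrite -[v]reprK !piE scale1r. Qed.
Lemma lq_scaleDr : right_distributive lq_scale +%R.
Proof.
move=> a u v; rewrite -[u]reprK -[v]reprK /GRing.add /=.
by rewrite !piE scalerDr.
Qed.
Lemma lq_scaleDl (v : lquot) : {morph lq_scale^~ v : a b / a + b}.
Proof.
by move=> a b; rewrite -[v]reprK [in RHS]/GRing.add /= !piE scalerDl.
Qed.
HB.instance Definition _ :=
  GRing.Zmodule_isLmodule.Build k lquot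
    lq_scaleA lq_scale1 lq_scaleDr lq_scaleDl.

Lemma lq_pi_linear : linear (\pi_lquot : V -> lquot).
Proof. by move=> a u v; rewrite lq_pi_add lq_pi_scale. Qed.
HB.instance Definition _ :=
  GRing.isLinear.Build k V lquot _ \pi_lquot lq_pi_linear.

End LmodQuot.

Section DgaTheory.
Variables (k : fieldType) (A : dga k).

Lemma dmulBl i j n (e : i + j = n) (x x' : A i) (y : A j) :
  dmul e (x - x') y = dmul e x y - dmul e x' y.
Proof. by rewrite addrC -scaleN1r dmul_linl scaleN1r addrC. Qed.

Lemma dmulBr i j n (e : i + j = n) (x : A i) (y y' : A j) :
  dmul e x (y - y') = dmul e x y - dmul e x y'.
Proof. by rewrite addrC -scaleN1r dmul_linr scaleN1r addrC. Qed.

Lemma dmul0l i j n (e : i + j = n) (y : A j) : dmul e (0 : A i) y = 0.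
Proof. by rewrite -(subrr 0) dmulBl subrr. Qed.

Lemma dmul0r i j n (e : i + j = n) (x : A i) : dmul e x (0 : A j) = 0.
Proof. by rewrite -(subrr 0) dmulBr subrr. Qed.

Lemma dmulDl i j n (e : i + j = n) (x x' : A i) (y : A j) :
  dmul e (x + x') y = dmul e x y + dmul e x' y.
Proof. by rewrite -[x]scale1r dmul_linl !scale1r. Qed.

Lemma dmulDr i j n (e : i + j = n) (x : A i) (y y' : A j) :
  dmul e x (y + y') = dmul e x y + dmul e x y'.
Proof. by rewrite -[y]scale1r dmul_linr !scale1r. Qed.

Lemma dd1 i (e : 0 + 1 = i) : dd A e (dunit A) = 0.
Proof.
case: i / e.
have := dleibniz (addr0 0) (erefl (0 + 1)) (erefl (0 + 1)) (addr0 (0 + 1))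
  (erefl (0 + 1)) (add0r (0 + 1)) (dunit A) (dunit A).
rewrite dmul1l expr0 scale1r dmul1l dmul1r => h.
by apply/(addrI (dd A (erefl (0 + 1)) (dunit A))); rewrite -h addr0.
Qed.

End DgaTheory.

Section Cohomology.
Variables (k : fieldType) (A : dga k).

Section Degree.
Variable j : int.

Definition cocycle : {pred A j} := fun x => dd A (erefl (j + 1)) x == 0.

Lemma cocycle_submod : submod_closed cocycle.
Proof.
split=> [|a u v]; rewrite !unfold_in ?linear0 //.
by move=> /eqP u0 /eqP v0; rewrite linearP u0 v0 scaler0 addr0.
Qed.
HB.instance Definition _ :=
  GRing.isSubmodClosed.Build k (A j) cocycle cocycle_submod.

Record cocycles := Cocycle { cval : A j; cvalP : cval \in cocycle }.
HB.instance Definition _ := [isSub for cval].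
HB.instance Definition _ := [Choice of cocycles by <:].
HB.instance Definition _ := [SubChoice_isSubLmodule of cocycles by <:].

Lemma dcval i (e : j + 1 = i) (x : cocycles) : dd A e (cval x) = 0.
Proof. by case: i / e; apply/eqP; case: x. Qed.

Definition coboundary : {pred cocycles} :=
  fun z => `[< exists y : A (j - 1), dd A (subrK 1 j) y = cval z >].

Lemma coboundary_submod : submod_closed coboundary.
Proof.
split=> [|a u v]; first by apply/asboolP; exists 0; rewrite linear0.
move=> /asboolP [x hx] /asboolP [y hy]; apply/asboolP; exists (a *: x + y).
by rewrite linearP hx hy.
Qed.
HB.instance Definition _ :=
  GRing.isSubmodClosed.Build k cocycles coboundary coboundary_submod.

Definition coh := lquot coboundary.
HB.instance Definition _ := EqQuotient.on coh.
HB.instance Definition _ := GRing.Lmodule.on coh.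

Lemma cohP (x y : cocycles) :
  \pi_coh x = \pi_coh y <->
  exists z : A (j - 1), dd A (subrK 1 j) z = cval x - cval y.
Proof.
have -> : \pi_coh x = \pi_coh y <-> x - y \in coboundary.
  exact: lquotP.
by rewrite unfold_in; split=> /asboolP.
Qed.

End Degree.

Fact Z0one_subproof : dunit A \in @cocycle 0.
Proof. by rewrite unfold_in dd1. Qed.
Definition Z0one := Cocycle Z0one_subproof.

Fact Z0mul_subproof (x y : cocycles 0) :
  dmul (addr0 0) (cval x) (cval y) \in @cocycle 0.
Proof.
rewrite unfold_in (dleibniz _ _ (erefl (0 + 1)) (addr0 (0 + 1))
  (erefl (0 + 1)) (add0r (0 + 1))).
by rewrite !dcval dmul0l dmul0r scaler0 addr0.
Qed.
Definition Z0mul (x y : cocycles 0) := Cocycle (Z0mul_subproof x y).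

Definition H0 := coh 0.
HB.instance Definition _ := EqQuotient.on H0.
HB.instance Definition _ := GRing.Lmodule.on H0.

Definition H0one : H0 := \pi_H0 Z0one.
Definition H0mul (x y : H0) : H0 := \pi_H0 (Z0mul (repr x) (repr y)).

Lemma H0mulE (x y : cocycles 0) :
  H0mul (\pi_H0 x) (\pi_H0 y) = \pi_H0 (Z0mul x y).
Proof.
rewrite /H0mul; set x' := repr _; set y' := repr _.
have [u hu] : exists u, dd A (subrK 1 0) u = cval x' - cval x.
  by apply/cohP; rewrite reprK.
have [v hv] : exists v, dd A (subrK 1 0) v = cval y' - cval y.
  by apply/cohP; rewrite reprK.
apply/cohP; exists (dmul (addr0 _) u (cval y') + dmul (add0r _) (cval x) v).
rewrite linearD /=.
rewrite (dleibniz _ _ (subrK 1 0) (addr0 0) (erefl (0 + 1)) (subrK 1 0)).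
rewrite (dleibniz _ _ (erefl (0 + 1)) (addrC _ _) (subrK 1 0) (addr0 0)).
rewrite !dcval hu hv dmul0l dmul0r scaler0 add0r addr0 expr0 scale1r.
by rewrite dmulBl dmulBr addrA subrK.
Qed.

Lemma H0mulA : associative H0mul.
Proof.
elim/quotW=> x; elim/quotW=> y; elim/quotW=> z.
rewrite (H0mulE y z) (H0mulE x y) (H0mulE x (Z0mul y z)) (H0mulE (Z0mul x y) z).
by congr (\pi_H0 _); apply: val_inj; rewrite /=; apply: dmulA.
Qed.

Lemma H0mul1l : left_id H0one H0mul.
Proof.
elim/quotW=> x; rewrite H0mulE.
by congr (\pi_H0 _); apply: val_inj; rewrite /=; apply: dmul1l.
Qed.

Lemma H0mul1r : right_id H0one H0mul.
Proof.
elim/quotW=> x; rewrite H0mulE.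
by congr (\pi_H0 _); apply: val_inj; rewrite /=; apply: dmul1r.
Qed.

Lemma H0mulDl : left_distributive H0mul +%R.
Proof.
elim/quotW=> x; elim/quotW=> y; elim/quotW=> z.
rewrite -(linearD \pi_H0) (H0mulE (x + y) z) (H0mulE x z) (H0mulE y z).
rewrite -(linearD \pi_H0).
by congr (\pi_H0 _); apply: val_inj; rewrite /=; apply: dmulDl.
Qed.

Lemma H0mulDr : right_distributive H0mul +%R.
Proof.
elim/quotW=> x; elim/quotW=> y; elim/quotW=> z.
rewrite -(linearD \pi_H0) (H0mulE x (y + z)) (H0mulE x y) (H0mulE x z).
rewrite -(linearD \pi_H0).
by congr (\pi_H0 _); apply: val_inj; rewrite /=; apply: dmulDr.
Qed.

HB.instance Definition _ := GRing.Zmodule_isPzRing.Build H0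
  H0mulA H0mul1l H0mul1r H0mulDl H0mulDr.

End Cohomology.

Section CohomologyMap.
Variables (k : fieldType) (A B : npDga k) (f : dgaHom A B) (j : int).

Fact cocycle_map_subproof (x : cocycles A j) :
  f j (cval x) \in @cocycle k B j.
Proof. by rewrite unfold_in -homd dcval linear0. Qed.
Definition cocycle_map (x : cocycles A j) := Cocycle (cocycle_map_subproof x).

Definition coh_map (x : coh A j) : coh B j :=
  \pi_(coh B j) (cocycle_map (repr x)).

Lemma coh_mapE (x : cocycles A j) :
  coh_map (\pi_(coh A j) x) = \pi_(coh B j) (cocycle_map x).
Proof.
have [u hu] : exists u, dd A (subrK 1 j) u =
    cval (repr (\pi_(coh A j) x)) - cval x by apply/cohP; rewrite reprK.
by apply/cohP; exists (f (j - 1) u); rewrite -homd hu linearB.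
Qed.

End CohomologyMap.

Definition quasi_iso_map (k : fieldType) (A B : npDga k) (f : dgaHom A B) :=
  forall j : int, bijective (coh_map f (j := j)).

(* A and B are linked by a finite zigzag of quasi-isomorphisms.               *)
Definition quasi_isomorphic (k : fieldType) : npDga k -> npDga k -> Prop :=
  clos_refl_sym_trans (npDga k)
    (fun A B => exists f : dgaHom A B, quasi_iso_map f).

Definition fin_dim (k : fieldType) (V : lmodType k) : Prop :=
  exists (n : nat) (e : 'I_n -> V),
    forall v : V, exists c : 'I_n -> k, v = \sum_(i < n) c i *: e i.

Definition coh_loc_finite (k : fieldType) (A : dga k) : Prop :=
  forall j : int, fin_dim (coh A j).

Definition left_ideal (R : pzRingType) (I : {pred R}) : Prop :=
  0 \in I /\ forall a : R, {in I &, forall u v, a * u + v \in I}.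

Definition maximal_left_ideal (R : pzRingType) (I : {pred R}) : Prop :=
  [/\ left_ideal I, 1 \notin I &
    forall J : {pred R}, left_ideal J -> 1 \notin J ->
      {subset I <= J} -> J =i I].

(* Local, for a not necessarily commutative ring: there is exactly one        *)
(* maximal left ideal.                                                        *)
Definition local_ring (R : pzRingType) : Prop :=
  exists2 M : {pred R}, maximal_left_ideal M &
    forall M' : {pred R}, maximal_left_ideal M' -> M' =i M.

Definition fin_total_dim (k : fieldType) (A : dga k) : Prop :=
  (forall i : int, fin_dim (A i)) /\
  exists N : nat, forall i : int, (N < `|i|)%N -> forall x : A i, x = 0.

(* The homogeneous elements of the n-th power of the augmentation ideal, the  *)
(* graded ideal of the homogeneous x with [aug x = 0].                        *)
Inductive aug_ideal_pow (k : fieldType) (A : augDga k) :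
    nat -> forall i : int, A i -> Prop :=
| AugPow0 i (x : A i) : aug_ideal_pow 0 x
| AugPowS n i j l (e : i + j = l) (x : A i) (y : A j) :
    aug A i x = 0 -> aug_ideal_pow n y -> aug_ideal_pow n.+1 (dmul e x y)
| AugPow_zero n i : aug_ideal_pow n (0 : A i)
| AugPow_add n i (x y : A i) :
    aug_ideal_pow n x -> aug_ideal_pow n y -> aug_ideal_pow n (x + y).

Definition artinian_local (k : fieldType) (A : augDga k) : Prop :=
  fin_total_dim A /\
  exists n : nat, forall (i : int) (x : A i), aug_ideal_pow n x -> x = 0.

Record category := Category {
  ob :> Type;
  mor : ob -> ob -> Type;
  idm : forall a, mor a a;
  compm : forall a b c, mor b c -> mor a b -> mor a c;
  comp1m : forall a b (f : mor a b), compm (idm b) f = f;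
  compm1 : forall a b (f : mor a b), compm f (idm a) = f;
  compmA : forall a b c d (f : mor c d) (g : mor b c) (h : mor a b),
    compm f (compm g h) = compm (compm f g) h
}.

Definition cofiltered (I : category) : Prop :=
  [/\ inhabited I,
      forall a b : I, exists c : I, inhabited (mor c a) /\ inhabited (mor c b) &
      forall (a b : I) (f g : mor a b),
        exists (c : I) (h : mor c a), compm f h = compm g h].

Record npDiagram (k : fieldType) (I : category) := NpDiagram {
  dob :> I -> npDga k;
  dmor : forall a b : I, mor a b -> dgaHom (dob a) (dob b);
  dmor_id : forall (a : I) i (x : dob a i), dmor (idm a) i x = x;
  dmor_comp : forall (a b c : I) (f : mor b c) (g : mor a b) i (x : dob a i),
    dmor (compm f g) i x = dmor f i (dmor g i x)
}.

Record proArtinian (k : fieldType) := ProArtinian {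
  pro_index : category;
  pro_cofiltered : cofiltered pro_index;
  pro_diagram :> npDiagram k pro_index;
  pro_artinian : forall a : pro_index, artinian_local (pro_diagram a)
}.

Definition is_cone (k : fieldType) (I : category) (D : npDiagram k I)
    (L : npDga k) (p : forall a : I, dgaHom L (D a)) : Prop :=
  forall (a b : I) (f : mor a b) i (x : L i), dmor D f i (p a i x) = p b i x.

(* L, with the projections p, is the limit of D in the category of            *)
(* nonpositively graded augmented dgas.                                       *)
Definition is_limit (k : fieldType) (I : category) (D : npDiagram k I)
    (L : npDga k) (p : forall a : I, dgaHom L (D a)) : Prop :=
  is_cone p /\
  forall (B : npDga k) (q : forall a : I, dgaHom B (D a)), is_cone q ->
    exists2 u : dgaHom B L,
      forall (a : I) i (x : B i), p a i (u i x) = q a i x &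
      forall u' : dgaHom B L,
        (forall (a : I) i (x : B i), p a i (u' i x) = q a i x) ->
        forall i (x : B i), u' i x = u i x.

Definition good (k : fieldType) (A : npDga k) : Prop :=
  (exists (P : proArtinian k) (L : npDga k)
      (p : forall a : pro_index P, dgaHom L (P a)),
    is_limit p /\ quasi_isomorphic A L) /\
  coh_loc_finite A.

(* Main.v *)
Require Import Defs.
From mathcomp Require Import all_boot all_order all_algebra.
From HB Require Import structures.
From Stdlib Require Import Relation_Operators.
From mathcomp Require Import generic_quotient boolp zify.
From mathcomp Require finmap.
From mathcomp.multinomials Require monalg.

(* From (i) to (ii): in a limit of Artinian local dgas, every [1 - x] of degree
   0 with [x] in the augmentation ideal has an inverse, by a geometric series
   in each term; this property of H^0 passes along quasi-isomorphisms and makes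
   the augmentation ideal of H^0 its only maximal left ideal.

   From (ii) to (i): the maximal ideal of H^0(A) is nilpotent. Resolve A by a
   free algebra T on finitely many generators in each degree, with a
   differential preserving the ideal m generated by them. Freeness and the
   nilpotence imply that for each degree there is a [c] such that every cocycle
   of m^(N+c) is a coboundary of m^N, for all [N]. Hence T is quasi-isomorphic
   to its m-adic completion, which is a limit of Artinian quotients since every
   T/m^N is finite-dimensional in each degree. The same vanishing, applied to
   the stages of the construction of T, bounds their cohomology and shows that
   finitely many new generators suffice at each stage. *)

Set Implicit Arguments.
Unset Strict Implicit.
Unset Printing Implicit Defensive.

Import GRing.Theory Num.Theory Order.TTheory.
Local Open Scope ring_scope.
Local Open Scope quotient_scope.

(** * Limits of diagrams of dgas *)

(** Letters of degree 0 are the obstacle: they make T infinite-dimensional in a given degree, so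
    finiteness has to come from word length. By nilpotence there is an [r] such that every word of
    [r] letters of degree 0 evaluates to a boundary of A, and injectivity of T -> A on H^0 makes the
    word itself a boundary of T. In a cocycle of weight [n] (minus the degree), trading such a block
    for an element that bounds it lowers the weight carried by the initial segments, at the cost of
    [r] letters of length. The possible weights 0, ..., [n] are exhausted after [n.+1] rounds,
    whence [c = r * n.+1]. As [c] does not depend on [N], corrections of approximate cocycles
    converge in the completion and no [lim^1] term arises. This argument presupposes injectivity on
    H^0, so the letters of weight 0 and 1 are chosen by hand, and only the later ones with its help.
    Since T/m^N is in general unbounded below, the Artinian quotients are truncated in degree as
    well. In the other direction, inverses in the terms of a limit fit together because two-sided
    inverses are unique. *)

Definition mk_linear (k : fieldType) (U V : lmodType k) (f : U -> V)
    (f_lin : linear f) : {linear U -> V} :=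
  HB.pack f (GRing.isLinear.Build k U V *:%R f f_lin).

Definition mk_scalar (k : fieldType) (U : lmodType k) (f : U -> k)
    (f_lin : scalar f) : {scalar U} :=
  HB.pack f (GRing.isLinear.Build k U k *%R f f_lin).

Lemma dmul_irr (k : fieldType) (A : dga k) i j n (e e' : i + j = n)
  (x : A i) (y : A j) : dmul e x y = dmul e' x y.
Proof. by rewrite (Prop_irrelevance e e'). Qed.

Lemma dd_irr (k : fieldType) (A : dga k) i j (e e' : i + 1 = j) (x : A i) :
  dd A e x = dd A e' x.
Proof. by rewrite (Prop_irrelevance e e'). Qed.

Section Limit.
Variables (k : fieldType) (I : category) (D : npDiagram k I).
Hypothesis cofI : cofiltered I.

Section Component.
Variable i : int.

Record lim_comp := LimComp {
  lval :> forall a : I, D a i;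
  lvalP : forall (a b : I) (f : mor a b), dmor D f i (lval a) = lval b
}.

Lemma lim_ext (x y : lim_comp) : (forall a, x a = y a) -> x = y.
Proof.
case: x y => [x xP] [y yP] /= exy.
have {}exy : x = y by apply: functional_extensionality_dep.
by subst y; congr LimComp; apply: Prop_irrelevance.
Qed.

HB.instance Definition _ := gen_eqMixin lim_comp.
HB.instance Definition _ := gen_choiceMixin lim_comp.

Program Definition lim_zero := @LimComp (fun a => 0) _.
Next Obligation. by rewrite linear0. Qed.
Program Definition lim_add (x y : lim_comp) := @LimComp (fun a => x a + y a) _.
Next Obligation. by rewrite linearD !lvalP. Qed.
Program Definition lim_opp (x : lim_comp) := @LimComp (fun a => - x a) _.
Next Obligation. by rewrite linearN !lvalP. Qed.
Program Definition lim_scale (c : k) (x : lim_comp) :=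
  @LimComp (fun a => c *: x a) _.
Next Obligation. by rewrite linearZ /= !lvalP. Qed.

Lemma lim_addA : associative lim_add.
Proof. by move=> x y z; apply: lim_ext => a; apply: addrA. Qed.
Lemma lim_addC : commutative lim_add.
Proof. by move=> x y; apply: lim_ext => a; apply: addrC. Qed.
Lemma lim_add0 : left_id lim_zero lim_add.
Proof. by move=> x; apply: lim_ext => a; apply: add0r. Qed.
Lemma lim_addN : left_inverse lim_zero lim_opp lim_add.
Proof. by move=> x; apply: lim_ext => a; apply: addNr. Qed.
HB.instance Definition _ :=
  GRing.isZmodule.Build lim_comp lim_addA lim_addC lim_add0 lim_addN.

Lemma lim_scaleA b c (x : lim_comp) :
  lim_scale b (lim_scale c x) = lim_scale (b * c) x.
Proof. by apply: lim_ext => a; apply: scalerA. Qed.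
Lemma lim_scale1 : left_id 1 lim_scale.
Proof. by move=> x; apply: lim_ext => a; apply: scale1r. Qed.
Lemma lim_scaleDr : right_distributive lim_scale +%R.
Proof. by move=> c x y; apply: lim_ext => a; apply: scalerDr. Qed.
Lemma lim_scaleDl (x : lim_comp) : {morph lim_scale^~ x : b c / b + c}.
Proof. by move=> b c; apply: lim_ext => a; apply: scalerDl. Qed.
HB.instance Definition _ := GRing.Zmodule_isLmodule.Build k lim_comp
  lim_scaleA lim_scale1 lim_scaleDr lim_scaleDl.

Lemma limDE (x y : lim_comp) a : (x + y) a = x a + y a. Proof. by []. Qed.
Lemma limZE c (x : lim_comp) a : (c *: x) a = c *: x a. Proof. by []. Qed.
End Component.

Program Definition lim_mul i j n (e : i + j = n)
    (x : lim_comp i) (y : lim_comp j) : lim_comp n :=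
  @LimComp _ (fun a => dmul e (x a) (y a)) _.
Next Obligation. by rewrite homM !lvalP. Qed.

Program Definition lim_one : lim_comp 0 := @LimComp _ (fun a => dunit (D a)) _.
Next Obligation. by rewrite hom1. Qed.

Program Definition lim_diff i j (e : i + 1 = j) (x : lim_comp i) :
  lim_comp j := @LimComp _ (fun a => dd (D a) e (x a)) _.
Next Obligation. by rewrite homd !lvalP. Qed.

Lemma lim_diff_linear i j (e : i + 1 = j) : linear (lim_diff e).
Proof. by move=> c x y; apply: lim_ext => a; apply: linearP. Qed.

Program Definition lim_dga := @Dga k (fun i => lim_comp i : lmodType k)
  lim_mul lim_one (fun i j e => mk_linear (lim_diff_linear e))
  _ _ _ _ _ _ _.
Next Obligation. by move=> c x x'; apply: lim_ext => a; apply: dmul_linl. Qed.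
Next Obligation. by move=> c y y'; apply: lim_ext => a; apply: dmul_linr. Qed.
Next Obligation. by apply: lim_ext => a; apply: dmulA. Qed.
Next Obligation. by apply: lim_ext => a; apply: dmul1l. Qed.
Next Obligation. by apply: lim_ext => a; apply: dmul1r. Qed.
Next Obligation. by apply: lim_ext => a; apply: ddd. Qed.
Next Obligation. by apply: lim_ext => a; apply: dleibniz. Qed.

Definition lim_base : I := let: And3 i0 _ _ := cofI in
  projT1 (cid (let: inhabits a := i0 in ex_intro (fun _ => True) a Logic.I)).

(** Two objects receive maps from a common third one, and transition maps preserve augmentations; so
    reading the augmentation at [lim_base] involves no real choice. *)
Lemma lim_aug_indep i (x : lim_comp i) (a b : I) :
  aug (D a) i (x a) = aug (D b) i (x b).
Proof.
case: cofI => _ /(_ a b) [c [[f] [g]]] _.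
by rewrite -(lvalP x f) -(lvalP x g) !hom_aug.
Qed.

Definition lim_aug i (x : lim_comp i) : k := aug (D lim_base) i (x lim_base).

Lemma lim_aug_linear i : scalar (@lim_aug i).
Proof. by move=> c x y; rewrite /lim_aug limDE limZE linearP. Qed.

Program Definition lim_augDga := @AugDga k lim_dga
  (fun i => mk_scalar (@lim_aug_linear i)) _ _ _ _.
Next Obligation. by rewrite /lim_aug aug_deg. Qed.
Next Obligation. by rewrite /lim_aug aug1. Qed.
Next Obligation. by rewrite /lim_aug augM. Qed.
Next Obligation. by rewrite /lim_aug augd. Qed.

Program Definition lim_npDga := @NpDga k lim_augDga _.
Next Obligation. by apply: lim_ext => a; apply: nonpos. Qed.

Lemma lim_proj_linear a i : linear (fun x : lim_npDga i => x a).
Proof. by []. Qed.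

Program Definition lim_proj (a : I) : dgaHom lim_npDga (D a) :=
  @DgaHom k lim_npDga (D a) (fun i => mk_linear (@lim_proj_linear a i))
   _ _ _ _.
Next Obligation. by rewrite /= /lim_aug; apply: lim_aug_indep. Qed.

Section Universal.
Variables (B : npDga k) (q : forall a : I, dgaHom B (D a)).
Hypothesis q_cone : is_cone q.

Definition lim_lift_fun i (x : B i) : lim_npDga i :=
  @LimComp i (fun a => q a i x) (fun a b f => q_cone f x).

Lemma lim_lift_linear i : linear (@lim_lift_fun i).
Proof. by move=> c x y; apply: lim_ext => a; apply: linearP. Qed.

Program Definition lim_lift : dgaHom B lim_npDga :=
  @DgaHom k B lim_npDga (fun i => mk_linear (@lim_lift_linear i)) _ _ _ _.
Next Obligation. by apply: lim_ext => a; apply: hom1. Qed.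
Next Obligation. by apply: lim_ext => a; apply: homM. Qed.
Next Obligation. by apply: lim_ext => a; apply: homd. Qed.
Next Obligation. by rewrite /= /lim_aug /= hom_aug. Qed.

End Universal.

Lemma lim_is_limit : is_limit lim_proj.
Proof.
split=> [a b f i x|B q qc]; first exact: lvalP.
exists (lim_lift qc) => // u hu i x.
by apply: lim_ext => a; apply: hu.
Qed.

End Limit.

(** * Good dgas have local zeroth cohomology *)

Section DgaHomOps.
Variable k : fieldType.

Lemma id_linear (V : lmodType k) : linear (fun x : V => x). Proof. by []. Qed.

Program Definition hom_id (A : npDga k) : dgaHom A A :=
  @DgaHom k A A (fun i => mk_linear (@id_linear (A i))) _ _ _ _.

Lemma comp_linear (U V W : lmodType k) (f : {linear U -> V})
  (g : {linear V -> W}) : linear (fun x => g (f x)).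
Proof. by move=> c x y; rewrite !linearP. Qed.

Program Definition hom_comp (A B C : npDga k) (f : dgaHom A B)
    (g : dgaHom B C) : dgaHom A C :=
  @DgaHom k A C (fun i => mk_linear (comp_linear (f i) (g i))) _ _ _ _.
Next Obligation. by rewrite /= !hom1. Qed.
Next Obligation. by rewrite /= !homM. Qed.
Next Obligation. by rewrite /= !homd. Qed.
Next Obligation. by rewrite /= !hom_aug. Qed.

End DgaHomOps.

(** * Boundaries and quasi-isomorphisms at the level of cochains *)

Section Boundaries.
Variables (k : fieldType) (A : dga k).

Lemma dmulZl i j n (e : i + j = n) c (x : A i) (y : A j) :
  dmul e (c *: x) y = c *: dmul e x y.
Proof. by rewrite -[c *: x]addr0 dmul_linl dmul0l addr0. Qed.

Lemma dmulZr i j n (e : i + j = n) c (x : A i) (y : A j) :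
  dmul e x (c *: y) = c *: dmul e x y.
Proof. by rewrite -[c *: y]addr0 dmul_linr dmul0r addr0. Qed.

(** The source degree is bound by an equation instead of being [j - 1], so that boundaries in
    computed degrees need no transport. *)
Definition bdry j (x : A j) : Prop :=
  exists i (e : i + 1 = j) (z : A i), dd A e z = x.

Lemma bdryE j (x : A j) :
  bdry x <-> exists z : A (j - 1), dd A (subrK 1 j) z = x.
Proof.
split=> [[i [e [z <-]]]|[z <-]]; last by exists (j - 1), (subrK 1 j), z.
have ei : i = j - 1 by lia.
by subst i; exists z; apply: dd_irr.
Qed.

Lemma bdry0 j : bdry (0 : A j).
Proof. by apply/bdryE; exists 0; rewrite linear0. Qed.

Lemma bdryD j (x y : A j) : bdry x -> bdry y -> bdry (x + y).
Proof.
by move=> /bdryE[u <-] /bdryE[v <-]; apply/bdryE; exists (u + v);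
  rewrite linearD.
Qed.

Lemma bdryZ j c (x : A j) : bdry x -> bdry (c *: x).
Proof. by move=> /bdryE[u <-]; apply/bdryE; exists (c *: u);
  rewrite linearZ. Qed.

Lemma bdryN j (x : A j) : bdry x -> bdry (- x).
Proof. by rewrite -scaleN1r; apply: bdryZ. Qed.

Lemma bdryB j (x y : A j) : bdry x -> bdry y -> bdry (x - y).
Proof. by move=> bx by_; apply/bdryD/bdryN. Qed.

Lemma bdry_cocycle j l (e : j + 1 = l) (x : A j) : bdry x -> dd A e x = 0.
Proof. by case=> i [e' [z <-]]; apply: ddd. Qed.

Lemma bdry_mull i j n (e : i + j = n) (x : A i) (y : A j) :
  bdry x -> dd A (erefl (j + 1)) y = 0 -> bdry (dmul e x y).
Proof.
case=> i' [e' [z <-]] yc.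
have en : (i' + j) + 1 = n by lia.
exists (i' + j), en, (dmul (erefl _) z y).
have e2 : i' + (j + 1) = n by lia.
by rewrite (dleibniz _ _ e' e (erefl (j + 1)) e2) yc dmul0r scaler0 addr0.
Qed.

Lemma bdry_mulr i j n (e : i + j = n) (x : A i) (y : A j) :
  dd A (erefl (i + 1)) x = 0 -> bdry y -> bdry (dmul e x y).
Proof.
move=> xc [j' [e' [z <-]]].
have en : (i + j') + 1 = n by lia.
(* The sign cancels the one of the Leibniz rule. *)
exists (i + j'), en, ((-1) ^+ `|i|%N *: dmul (erefl _) x z).
have e2 : (i + 1) + j' = n by lia.
rewrite linearZ /= (dleibniz _ _ (erefl (i +
  1)) e2 e' e) xc dmul0l add0r scalerA.
by rewrite -expr2 sqrr_sign scale1r.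
Qed.

Lemma coh_eqP j (x y : cocycles A j) :
  \pi_(coh A j) x = \pi_(coh A j) y <-> bdry (cval x - cval y).
Proof. by rewrite cohP bdryE. Qed.

End Boundaries.

Lemma hom_bdry (k : fieldType) (A B : npDga k) (f : dgaHom A B) j (x : A j) :
  bdry x -> bdry (f j x).
Proof. by case=> i [e [z <-]]; exists i, e, (f i z); rewrite homd. Qed.

Lemma aug_bdry (k : fieldType) (A : augDga k) j (x : A j) :
  bdry x -> aug A j x = 0.
Proof. by case=> i [e [z <-]]; apply: augd. Qed.

Lemma deg0_cocycle (k : fieldType) (A : npDga k) j (e : 0 + 1 = j) (x : A 0) :
  dd A e x = 0.
Proof. by apply: nonpos; rewrite -e. Qed.

Section QuasiIso.
Variables (k : fieldType) (A B : npDga k) (f : dgaHom A B).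

Fact mk_cocycleP (C : dga k) j (x : C j) :
  dd C (erefl (j + 1)) x = 0 -> x \in @cocycle k C j.
Proof. by move=> xc; rewrite unfold_in xc. Qed.

Lemma quasi_iso_surj j (y : B j) : quasi_iso_map f ->
  dd B (erefl (j + 1)) y = 0 ->
  exists2 x : A j, dd A (erefl (j + 1)) x = 0 & bdry (f j x - y).
Proof.
move=> /(_ j) [g _ gK] yc; set yz := Cocycle (mk_cocycleP yc).
have := gK (\pi_(coh B j) yz); move: (g _).
elim/quotW=> x; rewrite coh_mapE => /coh_eqP fx.
by exists (cval x); [apply: dcval|].
Qed.

Lemma quasi_iso_inj j (x : A j) : quasi_iso_map f ->
  dd A (erefl (j + 1)) x = 0 -> bdry (f j x) -> bdry x.
Proof.
move=> /(_ j) [g fK _] xc fx; set xz := Cocycle (mk_cocycleP xc).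
have := fK (\pi_(coh A j) xz); rewrite coh_mapE.
have -> : \pi_(coh B j) (cocycle_map f xz) = \pi_(coh B j) (cocycle_map f 0).
  by apply/coh_eqP; rewrite /= linear0 subr0.
by rewrite -coh_mapE fK => /esym/coh_eqP; rewrite /= subr0.
Qed.

Lemma quasi_iso_intro :
  (forall j (y : B j), dd B (erefl (j + 1)) y = 0 ->
    exists2 x : A j, dd A (erefl (j + 1)) x = 0 & bdry (f j x - y)) ->
  (forall j (x : A j), dd A (erefl (j + 1)) x = 0 -> bdry (f j x) -> bdry x) ->
  quasi_iso_map f.
Proof.
move=> fs fi j.
have fi' : injective (coh_map f (j := j)).
  elim/quotW=> x; elim/quotW=> y; rewrite !coh_mapE => /coh_eqP fxy.
  apply/coh_eqP/fi; first by rewrite linearB /= !dcval subrr.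
  by rewrite linearB.
have fs' (y : coh B j) : exists x, coh_map f x = y.
  elim/quotW: y => y; have [x xc fx] := fs j (cval y) (dcval _ _).
  exists (\pi_(coh A j) (Cocycle (mk_cocycleP xc))); rewrite coh_mapE.
  by apply/coh_eqP.
pose g y := projT1 (cid (fs' y)).
have fg y : coh_map f (g y) = y by rewrite /g; case: cid.
by exists g => // x; apply: fi'; rewrite fg.
Qed.

End QuasiIso.

(** * Unipotent elements and their inverses up to boundaries *)

Section UnipotentInverse.
Variable k : fieldType.

(** In H^0 this says that [1 - x] has a left inverse: elements of degree 0 are all cocycles because
    A is nonpositive. A left inverse is what left ideals need. *)
Definition unipotent_inv (A : npDga k) : Prop :=
  forall x : A 0, aug A 0 x = 0 ->
    exists y : A 0, bdry (dmul (addr0 0) y (dunit A - x) - dunit A).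

(** A preimage of [x] up to a boundary is again in the augmentation ideal, since augmentations kill
    boundaries; the image of its inverse serves for [x]. *)
Lemma unipotent_inv_fwd (A B : npDga k) (f : dgaHom A B) :
  quasi_iso_map f -> unipotent_inv A -> unipotent_inv B.
Proof.
move=> fq Ainv x x0.
have [x' _ bx] := quasi_iso_surj fq (deg0_cocycle (erefl (0 + 1)) x).
have [|y' by'] := Ainv x'.
  have := aug_bdry bx; rewrite linearB /= hom_aug x0 subr0; exact.
exists (f 0 y').
have -> : dmul (addr0 0) (f 0 y') (dunit B - x) - dunit B =
    f 0 (dmul (addr0 0) y' (dunit A - x') - dunit A) +
    dmul (addr0 0) (f 0 y') (f 0 x' - x).
  by rewrite !linearB /= homM !linearB /= hom1 addrAC -dmulDr addrA subrK.
by apply: bdryD; [apply: hom_bdry|apply: bdry_mulr; rewrite ?deg0_cocycle].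
Qed.

(** Surjectivity on H^0 lifts the inverse, and injectivity on H^0 reflects the relation it
    satisfies. *)
Lemma unipotent_inv_bwd (A B : npDga k) (f : dgaHom A B) :
  quasi_iso_map f -> unipotent_inv B -> unipotent_inv A.
Proof.
move=> fq Binv x x0.
have [|y by_] := Binv (f 0 x); first by rewrite hom_aug.
have [y' _ by'] := quasi_iso_surj fq (deg0_cocycle (erefl (0 + 1)) y).
exists y'; apply: (quasi_iso_inj fq); first by rewrite deg0_cocycle.
have -> : f 0 (dmul (addr0 0) y' (dunit A - x) - dunit A) =
    (dmul (addr0 0) y (dunit B - f 0 x) - dunit B) +
    dmul (addr0 0) (f 0 y' - y) (dunit B - f 0 x).
  by rewrite linearB /= homM !linearB /= hom1 addrAC -dmulDl [y + _]addrC subrK.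
by apply: bdryD => //; apply: bdry_mull; rewrite ?deg0_cocycle.
Qed.

Lemma unipotent_inv_quasi_isomorphic (A B : npDga k) :
  quasi_isomorphic A B -> unipotent_inv A <-> unipotent_inv B.
Proof.
elim=> {A B} [A B [f fq]|A|A B _ IH|A B C _ IH1 _ IH2].
- by split; [apply: unipotent_inv_fwd fq|apply: unipotent_inv_bwd fq].
- by [].
- by apply: iff_sym.
- exact: iff_trans IH1 IH2.
Qed.

End UnipotentInverse.

Section GeometricInverse.
Variables (k : fieldType) (A : augDga k).
Local Notation "x ** y" := (dmul (addr0 0) (x : A 0) (y : A 0)) (at level 40).

Lemma mul0A (x y z : A 0) : x ** (y ** z) = (x ** y) ** z.
Proof. exact: dmulA. Qed.

(** Inverses on both sides are unique, hence preserved by transition maps; this makes them a point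
    of the limit. *)
Definition two_sided_inverse (x y : A 0) :=
  x ** y = dunit A /\ y ** x = dunit A.

Lemma two_sided_inverse_unique (x y y' : A 0) :
  two_sided_inverse x y -> two_sided_inverse x y' -> y = y'.
Proof.
move=> [_ yx] [xy' _].
by rewrite -[y](dmul1r (addr0 0)) -xy' mul0A yx dmul1l.
Qed.

Lemma artinian_unipotent_inverse (x : A 0) : artinian_local A ->
  aug A 0 x = 0 ->
  exists y, two_sided_inverse (dunit A - x) y.
Proof.
move=> [_ [n An]] x0.
pose pw m := iter m (fun t => x ** t) (dunit A).
(* Powers grow on the left, to match [AugPowS]; commutation with [x] gives the telescoping sum on
   the other side. *)
have pwS m : pw m.+1 = pw m ** x.
  elim: m => [|m IH]; first by rewrite /pw /= dmul1l dmul1r.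
  by rewrite -[pw m.+2]/(x ** pw m.+1) {1}IH mul0A.
have pwI m : aug_ideal_pow m (pw m).
  by elim: m => [|m IH]; [apply: AugPow0|apply: AugPowS].
have pwn : pw n = 0 by apply: An.
have telescope_r m : (dunit A - x) ** (\sum_(i < m) pw i) = dunit A - pw m.
  elim: m => [|m IH]; first by rewrite big_ord0 dmul0r subrr.
  rewrite big_ord_recr /= dmulDr IH dmulBl dmul1l addrA subrK.
  by [].
have telescope_l m : (\sum_(i < m) pw i) ** (dunit A - x) = dunit A - pw m.
  elim: m => [|m IH]; first by rewrite big_ord0 dmul0l subrr.
  by rewrite big_ord_recr /= dmulDl IH dmulBr dmul1r -pwS addrA subrK.
by exists (\sum_(i < n) pw i); split;
  rewrite ?telescope_r ?telescope_l pwn subr0.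
Qed.

End GeometricInverse.

Lemma limit_unipotent_inv (k : fieldType) (P : proArtinian k) (L : npDga k)
    (p : forall a : pro_index P, dgaHom L (P a)) :
  is_limit p -> unipotent_inv L.
Proof.
move=> [pc pu] x x0.
(* [L] is known only by its universal property. It is a retract of the explicit limit [L'], and the
   retraction [u] carries inverses from [L'] to [L]. *)
pose L' := lim_npDga P (pro_cofiltered P).
have [lc _] := lim_is_limit P (pro_cofiltered P).
have [u up _] := pu L' _ lc.
pose v : dgaHom L L' := lim_lift (pro_cofiltered P) pc.
have [w _ wu] := pu L p pc.
have uv i (y : L i) : u i (v i y) = y.
  have vuE : hom_comp v u i y = w i y by apply: wu => a j z /=; rewrite up.
  by apply: etrans vuE (esym _); apply: (wu (hom_id L)).
have xa0 a : aug (P a) 0 (p a 0 x) = 0 by rewrite hom_aug.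
pose inv a := projT1 (cid (artinian_unipotent_inverse (pro_artinian a) (xa0
  a))).
have invP a : two_sided_inverse (dunit (P a) - p a 0 x) (inv a).
  by rewrite /inv; case: cid.
have inv_comp a b (f : mor a b) : dmor P f 0 (inv a) = inv b.
  apply: (two_sided_inverse_unique _ (invP b)).
  rewrite -(pc a b f) -(hom1 (dmor P f)) -linearB.
  by case: (invP a) => h1 h2; split; rewrite -homM ?h1 ?h2 hom1.
pose y : L' 0 := LimComp inv_comp.
exists (u 0 y).
suff -> : dmul (addr0 0) (u 0 y) (dunit L - x) = dunit L.
  by rewrite subrr; apply: bdry0.
rewrite -[dunit L - x]uv -homM -[RHS](hom1 u); congr (u 0 _).
apply: lim_ext => a /=; rewrite linearB /= hom1.
by case: (invP a).
Qed.

(** * The ring H^0 and its augmentation ideal *)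

Section Local.
Variables (k : fieldType) (A : npDga k).

Fact cocycle0P (x : A 0) : x \in @cocycle k A 0.
Proof. by rewrite unfold_in deg0_cocycle. Qed.

Definition h0 (x : A 0) : H0 A := \pi_(H0 A) (Cocycle (cocycle0P x)).

Lemma h0_linear : linear h0.
Proof.
move=> c x y; rewrite /h0 -linearP; congr (\pi_(H0 A) _).
exact: val_inj.
Qed.
HB.instance Definition _ := GRing.isLinear.Build k (A 0) (H0 A) _ h0 h0_linear.

Lemma h0M x y : h0 (dmul (addr0 0) x y) = h0 x * h0 y.
Proof.
by rewrite /h0 [RHS]H0mulE; congr (\pi_(H0 A) _); apply: val_inj.
Qed.

Lemma h01 : h0 (dunit A) = 1.
Proof. by congr (\pi_(H0 A) _); apply: val_inj. Qed.

Lemma h0_surj (u : H0 A) : exists x, h0 x = u.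
Proof.
elim/quotW: u => x; exists (cval x).
by congr (\pi_(H0 A) _); apply: val_inj.
Qed.

Lemma h0_eq x y : h0 x = h0 y <-> bdry (x - y).
Proof. exact: coh_eqP. Qed.

Lemma h0_eq0 x : h0 x = 0 <-> bdry x.
Proof. by rewrite -(linear0 h0) h0_eq subr0. Qed.

(** Scalars act through multiples of 1, so left ideals of [H0 A] are subspaces. *)
Lemma H0scale c (u : H0 A) : c *: u = (c *: (1 : H0 A) : H0 A) * u.
Proof.
have [x <-] := h0_surj u.
by rewrite -h01 -!linearZ -h0M dmulZl dmul1l.
Qed.

(** The kernel of the augmentation on H^0, described by representatives so that the augmentation
    need not descend to the quotient first. *)
Definition aug_ker : {pred H0 A} :=
  fun u => `[< exists2 x, aug A 0 x = 0 & h0 x = u >].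

Lemma aug_kerP x : h0 x \in aug_ker <-> aug A 0 x = 0.
Proof.
split=> [/asboolP[y y0] /h0_eq /aug_bdry|x0]; last by apply/asboolP; exists x.
by rewrite linearB /= y0 sub0r => /eqP; rewrite oppr_eq0 => /eqP.
Qed.

Lemma aug_ker_left_ideal : left_ideal aug_ker.
Proof.
split=> [|a u v]; first by rewrite -(linear0 h0); apply/aug_kerP;
  rewrite linear0.
have [x <-] := h0_surj a; have [y <-] := h0_surj u; have [z <-] := h0_surj v.
move=> /aug_kerP y0 /aug_kerP z0; rewrite -h0M -linearD; apply/aug_kerP.
by rewrite linearD /= augM y0 z0 mulr0 addr0.
Qed.

Lemma aug_ker_one : 1 \notin aug_ker.
Proof.
by apply/negP; rewrite -h01 => /aug_kerP; rewrite aug1 => /eqP;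
  rewrite oner_eq0.
Qed.

Lemma aug_ker_codim (u : H0 A) : exists c : k, u - c *: (1 : H0 A) \in aug_ker.
Proof.
have [x <-] := h0_surj u; exists (aug A 0 x).
rewrite -h01 -linearZ -linearB; apply/aug_kerP.
by rewrite linearB linearZ /= aug1 mulr1 subrr.
Qed.

Lemma left_ideal_sub (R : pzRingType) (I : {pred R}) u v :
  left_ideal I -> u \in I -> v \in I -> u - v \in I.
Proof. by move=> [_ hI] uI vI; rewrite addrC -mulN1r; apply: hI. Qed.

Lemma left_ideal_mul (R : pzRingType) (I : {pred R}) a u :
  left_ideal I -> u \in I -> a * u \in I.
Proof. by move=> [I0 hI] uI; rewrite -[a * u]addr0; apply: hI. Qed.

(** The codimension is one: a larger ideal contains a nonzero multiple of 1. *)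
Lemma aug_ker_maximal : maximal_left_ideal aug_ker.
Proof.
split; [exact: aug_ker_left_ideal|exact: aug_ker_one|move=> J JI J1 sub u].
apply/idP/idP; last exact: sub.
move=> uJ; have [c uc] := aug_ker_codim u; have [c0|c0] := eqVneq c 0.
  by move: uc; rewrite c0 scale0r subr0.
case/negP: J1.
have cJ : c *: (1 : H0 A) \in J.
  by rewrite -[c *: (1 : H0 A)](subKr u); apply: left_ideal_sub => //;
    apply: sub.
have := left_ideal_mul (c^-1 *: (1 : H0 A) : H0 A) JI cJ.
by rewrite -H0scale scalerA mulVf // scale1r.
Qed.

(** An element outside [aug_ker] is, up to a nonzero scalar, of the form [1 - x] with [x] of
    augmentation 0, hence left invertible. So every proper left ideal lies in [aug_ker]. *)
Lemma unipotent_inv_local : unipotent_inv A -> local_ring (H0 A).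
Proof.
move=> Ainv; exists aug_ker; first exact: aug_ker_maximal.
move=> M' [M'I M'1 M'max]; suff sub : {subset M' <= aug_ker}.
  by move=> u; rewrite (M'max aug_ker aug_ker_left_ideal aug_ker_one sub).
move=> u uM'; apply/negPn/negP => uK; case/negP: M'1.
have [c uc] := aug_ker_codim u.
have c0 : c != 0.
  by apply/eqP => c0; move: uc; rewrite c0 scale0r subr0 (negPf uK).
have /asboolP[x x0 xE] : 1 - c^-1 *: u \in aug_ker.
  have := left_ideal_mul (- (c^-1 *: (1 : H0 A) : H0 A)) aug_ker_left_ideal uc.
  by rewrite mulNr -H0scale scalerBr scalerA mulVf // scale1r opprB.
have [y /h0_eq] := Ainv x x0.
rewrite h0M linearB /= h01 xE subKr => <-.
rewrite H0scale; apply: left_ideal_mul => //.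
exact: left_ideal_mul.
Qed.

End Local.

Lemma good_local (k : fieldType) (A : npDga k) : good A -> local_ring (H0 A).
Proof.
move=> [[P [L [p [/limit_unipotent_inv Linv AL]]]] _].
by apply: unipotent_inv_local; apply/(unipotent_inv_quasi_isomorphic AL).
Qed.

(** * Nilpotence of the maximal ideal *)

Section Nilpotent.
Variable k : fieldType.

(** With [n] the size of a spanning family, the [n.+1] by [n] matrix of coordinates has a nonzero
    left kernel. The bound depends on [V] only; it also becomes the nilpotence exponent. *)
Lemma fin_dim_dependent (V : lmodType k) : fin_dim V ->
  exists n : nat, forall v : 'I_n.+1 -> V,
    exists2 a : 'I_n.+1 -> k, exists i, a i != 0 & \sum_i a i *: v i = 0.
Proof.
move=> [n [e eP]]; exists n => v.
pose c i := projT1 (cid (eP (v i))).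
have vE i : v i = \sum_j c i j *: e j by rewrite /c; case: cid.
pose C : 'M[k]_(n.+1, n) := \matrix_(i, j) c i j.
have kerC : kermx C != 0.
  rewrite -mxrank_eq0 mxrank_ker subn_eq0 -ltnNge ltnS; exact: rank_leq_col.
have [r rC] : exists r, row r (kermx C) != 0.
  apply/existsP; rewrite -negb_forall; apply: contra kerC => /forallP kC.
  by apply/eqP/row_matrixP => i; rewrite row0; apply/eqP.
pose a : 'rV[k]_n.+1 := row r (kermx C).
have aC : a *m C = 0.
  by apply/sub_kermxP; apply: row_sub.
exists (fun i => a 0 i).
  apply/existsP; rewrite -negb_forall; apply: contra rC => /forallP a0.
  by apply/eqP/rowP => i; rewrite [RHS]mxE; apply/eqP.
under eq_bigr => i _ do rewrite vE scaler_sumr.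
rewrite exchange_big /= big1 // => j _.
under eq_bigr => i _ do rewrite scalerA.
rewrite -scaler_suml.
have := congr1 (fun B : 'rV_n => B 0 j) aC; rewrite !mxE => aCj.
suff -> : \sum_i a 0 i * c i j = 0 by rewrite scale0r.
by rewrite -[RHS]aCj; apply: eq_bigr => i _; rewrite [C _ _]mxE.
Qed.

Variable A : npDga k.
Local Notation R := (H0 A).

Lemma left_idealZ (J : {pred R}) (c : k) (u : R) :
  left_ideal J -> u \in J -> c *: u \in J.
Proof. by move=> JI uJ; rewrite H0scale; apply: left_ideal_mul. Qed.

Lemma left_idealD (J : {pred R}) (u v : R) :
  left_ideal J -> u \in J -> v \in J -> u + v \in J.
Proof. by move=> [_ JI] uJ vJ; rewrite -[u]mul1r; apply: JI. Qed.

Lemma left_ideal_sum (J : {pred R}) (I : Type) (r : seq I) (P : pred I)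
    (F : I -> R) :
  left_ideal J -> (forall i, P i -> F i \in J) -> \sum_(i <- r | P i) F i \in J.
Proof.
move=> JI FJ; elim/big_ind: _ => //; first by case: JI.
by move=> u v; apply: left_idealD.
Qed.

(** Finite dimension takes the place of Zorn's lemma: without a maximal ideal there is an endless
    strictly ascending chain of left ideals, and vectors [v i] picked in its successive steps would
    be linearly independent. *)
Lemma exists_maximal_left_ideal (I0 : {pred R}) : fin_dim R ->
  left_ideal I0 -> 1 \notin I0 ->
  exists2 M : {pred R}, maximal_left_ideal M & {subset I0 <= M}.
Proof.
move=> fdR I0I I01; apply: contrapT => noM.
pose proper (J : {pred R}) :=
  [/\ left_ideal J, 1 \notin J & {subset I0 <= J}].
have next (J : {J | proper J}) : exists J' : {J' | proper J'},
    {subset sval J <= sval J'} /\ exists2 v, v \in sval J' & v \notin sval J.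
  case: J => J [JI J1 subJ] /=; apply: contrapT => noJ.
  case: noM; exists J => //; split=> // J' J'I J'1 JJ' v.
  apply/idP/idP=> [vJ'|]; last exact: JJ'.
  apply: contrapT => /negP vJ; apply: noJ.
  have pJ' : proper J' by split=> // u /subJ/JJ'.
  by exists (exist _ J' pJ'); split=> //; exists v.
pose nx J := projT1 (cid (next J)).
have nxP J : {subset sval J <= sval (nx J)} /\
    exists2 v, v \in sval (nx J) & v \notin sval J by rewrite /nx; case: cid.
have p0 : proper I0 by split.
pose J i := iter i nx (exist _ I0 p0).
have JS i : exists v, v \in sval (J i.+1) /\ v \notin sval (J i).
  by have [_ [v]] := nxP (J i); exists v.
pose v i := projT1 (cid (JS i)).
have vP i : v i \in sval (J i.+1) /\ v i \notin sval (J i).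
  by rewrite /v; case: cid.
have Jmono i j : (i <= j)%N -> {subset sval (J i) <= sval (J j)}.
  elim: j => [|j IH]; first by rewrite leqn0 => /eqP ->.
  rewrite leq_eqVlt => /orP[/eqP -> //|/IH Jij] u /Jij.
  by case: (nxP (J j)) => h _; apply: h.
have JI i : left_ideal (sval (J i)) by case: (J i) => ? [].
have [n /(_ (fun i => v i)) [a [i0 ai0]]] := fin_dim_dependent fdR.
(* At the last index [i] of the relation, [v i] is a combination of earlier vectors, which all lie
   in [J i]. *)
case: (@arg_maxnP _ i0 (fun i => a i != 0) id ai0) => i ai imax.
rewrite (bigD1 i) //= => /eqP; rewrite addr_eq0 => /eqP avi.
case: (vP i) => _ /negP; apply.
rewrite -[v i]scale1r -(mulVf ai) -scalerA avi; apply: left_idealZ => //.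
rewrite -scaleN1r; apply: left_idealZ => //.
apply: left_ideal_sum => // j ji; have [->|aj] := eqVneq (a j) 0.
  by rewrite scale0r; case: (JI i).
apply: left_idealZ => //; apply: (Jmono j.+1); last by case: (vP j).
by rewrite ltn_neqAle ji; apply: imax.
Qed.

Hypotheses (fdR : fin_dim R) (locR : local_ring R).

(** Otherwise the left ideal generated by [1 - u] lies in a maximal one, which is [aug_ker] by
    locality; it would contain [(1 - u) + u = 1]. *)
Lemma local_left_inverse (u : R) : u \in @aug_ker k A ->
  exists y, y * (1 - u) = 1.
Proof.
move=> uM; apply: contrapT => noinv.
pose I0 : {pred R} := fun w => `[< exists y, w = y * (1 - u) >].
have I0I : left_ideal I0.
  split; first by apply/asboolP; exists 0; rewrite mul0r.
  move=> a x y /asboolP[x' ->] /asboolP[y' ->]; apply/asboolP.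
  by exists (a * x' + y'); rewrite mulrDl mulrA.
have I01 : 1 \notin I0.
  by apply/negP => /asboolP[y yE]; apply: noinv; exists y.
have [M Mmax subM] := exists_maximal_left_ideal fdR I0I I01.
have [M0 _ M0u] := locR.
have ME : M =i @aug_ker k A.
  by move=> w; rewrite (M0u _ Mmax) (M0u _ (aug_ker_maximal A)).
have uM' : 1 - u \in @aug_ker k A.
  by rewrite -ME; apply: subM; apply/asboolP; exists 1; rewrite mul1r.
have := left_idealD (aug_ker_left_ideal A) uM' uM.
by rewrite subrK (negPf (aug_ker_one A)).
Qed.

(** Products of arbitrary elements, because nilpotence of the ideal is wanted and not just of its
    elements. Factors are added on the left, so that later products lie in the left ideal generated
    by earlier ones. *)
Fixpoint iprod (s : nat -> A 0) (n : nat) : A 0 :=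
  if n is m.+1 then dmul (addr0 0) (s m) (iprod s m) else dunit A.

(* The partial products [q_i] of [n + 1] elements are linearly dependent; in a
   relation with first index [i], all later terms lie in [M * q_i], so that
   [q_i = 0] because [1 - m] has a left inverse for [m] in [M]. *)
Lemma local_nilpotent : exists n, forall s : nat -> A 0,
  (forall i, aug A 0 (s i) = 0) -> bdry (iprod s n).
Proof.
have [n nP] := fin_dim_dependent fdR; exists n => s s0; apply/h0_eq0.
pose q i := h0 (iprod s i).
have qS i j : (i < j)%N -> exists2 m, m \in @aug_ker k A & q j = m * q i.
  elim: j => // j IH; rewrite ltnS leq_eqVlt => /orP[/eqP <-|/IH[m mM qj]].
    by exists (h0 (s i)); [apply/aug_kerP|rewrite /q /= h0M].
  exists (h0 (s j) * m); last by rewrite /q /= h0M -mulrA -qj.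
  by apply: left_ideal_mul => //; apply: aug_ker_left_ideal.
have [a [i0 ai0]] := nP (fun i => q i).
case: (@arg_minnP _ i0 (fun i => a i != 0) id ai0) => i ai imin.
rewrite (bigD1 i) //= => aq.
have [m mM mE] : exists2 m, m \in @aug_ker k A &
    \sum_(j < n.+1 | j != i) a j *: q j = m * q i.
  elim/big_ind: _ => [|u v [m mM ->] [m' m'M ->]|j ji].
  - exists 0; last by rewrite mul0r.
    by case: (aug_ker_left_ideal A).
  - exists (m + m'); last by rewrite mulrDl.
    by apply: left_idealD => //; apply: aug_ker_left_ideal.
  have [->|aj] := eqVneq (a j) 0.
    exists 0; last by rewrite mul0r scale0r.
    by case: (aug_ker_left_ideal A).
  have [|m mM ->] := qS i j; first by rewrite ltn_neqAle eq_sym ji; apply: imin.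
  exists (a j *: m); first by apply: left_idealZ => //;
    apply: aug_ker_left_ideal.
  by rewrite H0scale mulrA -H0scale.
have [y yE] : exists y, y * (1 - (- (a i)^-1 *: m)) = 1.
  apply: local_left_inverse; apply: left_idealZ => //.
  exact: aug_ker_left_ideal.
have qi0 : q i = 0.
  rewrite -[q i]mul1r -yE -mulrA mulrBl mul1r scaleNr mulNr opprK.
  rewrite [_ *: m]H0scale -mulrA -mE -H0scale -[q i in X in X + _]scale1r.
  by rewrite -(mulVf ai) -scalerA -scalerDr aq scaler0 mulr0.
(* The product of all [n] factors is a left multiple of [q i], so it vanishes too. *)
have [->//|ni] := eqVneq n i.
have [|m' _] := qS i n; first by rewrite ltn_neqAle eq_sym ni -ltnS ltn_ord.
by rewrite qi0 mulr0.
Qed.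

End Nilpotent.

(** * Completion of a dga along a filtration *)

Section SubmodClosed.
Variables (k : fieldType) (V : lmodType k) (S : submodClosed V).

Lemma submodN x : (- x \in S) = (x \in S).
Proof. by apply/idP/idP=> /(rpredZ (-1)); rewrite !scaleN1r ?opprK. Qed.

Lemma submodB x y : x \in S -> y \in S -> x - y \in S.
Proof. by move=> xS yS; rewrite rpredD ?submodN. Qed.

End SubmodClosed.

(** * Quotient of an augmented dga by a differential ideal *)

Section Quotient.
Variables (k : fieldType) (T : npDga k) (J : forall i :
  int, submodClosed (T i)).
Hypothesis J_mull : forall i j n (e : i + j = n) (x : T i) (y : T j),
  x \in J i -> dmul e x y \in J n.
Hypothesis J_mulr : forall i j n (e : i + j = n) (x : T i) (y : T j),
  y \in J j -> dmul e x y \in J n.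
Hypothesis J_d : forall i j (e : i + 1 = j) (x : T i),
  x \in J i -> dd T e x \in J j.
Hypothesis J_aug : forall i (x : T i), x \in J i -> aug T i x = 0.

Let Q i : lmodType k := lquot (J i).
Definition qpi i (x : T i) : Q i := \pi_(lquot (J i)) x.

Lemma qpi_eq i (x y : T i) : qpi x = qpi y <-> x - y \in J i.
Proof. exact: lquotP. Qed.

Lemma qpi_linear i : linear (@qpi i).
Proof. exact: lq_pi_linear. Qed.
HB.instance Definition _ i := GRing.isLinear.Build k (T i) (Q i) _ (@qpi i)
  (@qpi_linear i).

Lemma qpi_surj i (u : Q i) : exists x, qpi x = u.
Proof. by elim/quotW: u => x; exists x. Qed.

Lemma repr_qpi i (x : T i) : repr (qpi x) - x \in J i.
Proof. by apply/qpi_eq; apply: (reprK (qpi x)). Qed.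

Definition qmul i j n (e : i + j = n) (u : Q i) (v : Q j) : Q n :=
  qpi (dmul e (repr u) (repr v)).

Lemma qmulE i j n (e : i + j = n) (x : T i) (y : T j) :
  qmul e (qpi x) (qpi y) = qpi (dmul e x y).
Proof.
apply/qpi_eq; rewrite -(subrKA (dmul e x (repr (qpi y)))) -dmulBl -dmulBr.
by apply: rpredD; [apply: J_mull|apply: J_mulr]; apply: repr_qpi.
Qed.

Definition qdiff i j (e : i + 1 = j) (u : Q i) : Q j := qpi (dd T e (repr u)).

Lemma qdiffE i j (e : i + 1 = j) (x : T i) : qdiff e (qpi x) = qpi (dd T e x).
Proof. by apply/qpi_eq; rewrite -linearB J_d ?repr_qpi. Qed.

Lemma qdiff_linear i j (e : i + 1 = j) : linear (qdiff e).
Proof.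
move=> c u v; have [x <-] := qpi_surj u; have [y <-] := qpi_surj v.
by rewrite -linearP !qdiffE !linearP.
Qed.

Program Definition quot_dga := @Dga k Q qmul (qpi (dunit T))
  (fun i j e => mk_linear (qdiff_linear e)) _ _ _ _ _ _ _.
Next Obligation.
move=> c u u'; have [x <-] := qpi_surj u; have [x' <-] := qpi_surj u'.
have [z <-] := qpi_surj y.
by rewrite -linearP !qmulE dmul_linl linearP.
Qed.
Next Obligation.
move=> c u u'; have [y <-] := qpi_surj u; have [y' <-] := qpi_surj u'.
have [z <-] := qpi_surj x.
by rewrite -linearP !qmulE dmul_linr linearP.
Qed.
Next Obligation.
move: x y z => u v w; have [x <-] := qpi_surj u; have [y <-] := qpi_surj v.
by have [z <-] := qpi_surj w; rewrite !qmulE; congr (qpi _); apply: dmulA.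
Qed.
Next Obligation. by have [y <-] := qpi_surj x; rewrite qmulE dmul1l. Qed.
Next Obligation. by have [y <-] := qpi_surj x; rewrite qmulE dmul1r. Qed.
Next Obligation.
by have [y <-] := qpi_surj x; rewrite /= !qdiffE ddd linear0.
Qed.
Next Obligation.
move: x y => u v; have [x <-] := qpi_surj u; have [y <-] := qpi_surj v.
by rewrite /= !(qmulE, qdiffE) (dleibniz _ _ erefl e1 erefl e2) linearD linearZ.
Qed.

Definition qaug i (u : Q i) : k := aug T i (repr u).

Lemma qaugE i (x : T i) : qaug (qpi x) = aug T i x.
Proof.
by apply/eqP; rewrite -subr_eq0 -linearB /= J_aug ?repr_qpi.
Qed.

Lemma qaug_linear i : scalar (@qaug i).
Proof.
move=> c u v; have [x <-] := qpi_surj u; have [y <-] := qpi_surj v.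
by rewrite -linearP !qaugE linearP.
Qed.

Program Definition quot_augDga := @AugDga k quot_dga
  (fun i => mk_scalar (@qaug_linear i)) _ _ _ _.
Next Obligation. by have [y <-] := qpi_surj x; rewrite qaugE aug_deg. Qed.
Next Obligation. by rewrite qaugE aug1. Qed.
Next Obligation.
move: x y => u v; have [x <-] := qpi_surj u; have [y <-] := qpi_surj v.
by rewrite qmulE !qaugE augM.
Qed.
Next Obligation.
by have [y <-] := qpi_surj x; rewrite /= qdiffE qaugE augd.
Qed.

Program Definition quot_npDga := @NpDga k quot_augDga _.
Next Obligation.
by have [y <-] := qpi_surj x; rewrite (nonpos H y) linear0.
Qed.

Program Definition quot_proj : dgaHom T quot_npDga :=
  @DgaHom k T quot_npDga (fun i => mk_linear (@qpi_linear i)) _ _ _ _.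
Next Obligation. by rewrite /= qmulE. Qed.
Next Obligation. by rewrite /= qdiffE. Qed.
Next Obligation. by rewrite /= qaugE. Qed.

Section Lift.
Variables (B : npDga k) (f : dgaHom T B).
Hypothesis fJ : forall i (x : T i), x \in J i -> f i x = 0.

Definition quot_lift_fun i (u : Q i) : B i := f i (repr u).

Lemma quot_liftE i (x : T i) : quot_lift_fun (qpi x) = f i x.
Proof. by apply/eqP; rewrite -subr_eq0 -linearB /= fJ ?repr_qpi. Qed.

Lemma quot_lift_linear i : linear (@quot_lift_fun i).
Proof.
move=> c u v; have [x <-] := qpi_surj u; have [y <-] := qpi_surj v.
by rewrite -linearP !quot_liftE linearP.
Qed.

Program Definition quot_lift : dgaHom quot_npDga B :=
  @DgaHom k quot_npDga B (fun i => mk_linear (@quot_lift_linear i)) _ _ _ _.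
Next Obligation. by rewrite quot_liftE hom1. Qed.
Next Obligation.
move: x y => u v; have [x <-] := qpi_surj u; have [y <-] := qpi_surj v.
by rewrite /= qmulE !quot_liftE homM.
Qed.
Next Obligation.
by have [y <-] := qpi_surj x; rewrite /= qdiffE !quot_liftE homd.
Qed.
Next Obligation.
by have [y <-] := qpi_surj x; rewrite /= qaugE quot_liftE hom_aug.
Qed.

End Lift.

End Quotient.

Definition nat_op : category :=
  @Category nat (fun a b => (b <= a)%N) (fun a => leqnn a)
    (fun a b c (f : (c <= b)%N) (g : (b <= a)%N) => leq_trans f g)
    (fun _ _ _ => Prop_irrelevance _ _) (fun _ _ _ => Prop_irrelevance _ _)
    (fun _ _ _ _ _ _ _ => Prop_irrelevance _ _).

Lemma nat_op_cofiltered : cofiltered nat_op.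
Proof.
split; first exact: inhabits 0%N.
- move=> a b; exists (maxn a b).
  by split; apply: inhabits; rewrite /= (leq_maxl, leq_maxr).
- move=> a b f g; exists a, (leqnn a); exact: (@Prop_irrelevance (b <= a)%N).
Qed.

(** * Completion along a multiplicative filtration with pro-zero cohomology *)

Section Filtration.
Variables (k : fieldType) (T : npDga k).
Variable F : nat -> forall i : int, submodClosed (T i).
Hypothesis F0 : forall i (x : T i), x \in F 0 i.
Hypothesis F_decr : forall n i (x : T i), x \in F n.+1 i -> x \in F n i.
Hypothesis F_aug : forall i (x : T i), x \in F 1 i -> aug T i x = 0.
Hypothesis F_mull : forall N i j n (e : i + j = n) (x : T i) (y : T j),
  x \in F N i -> dmul e x y \in F N n.
Hypothesis F_mulr : forall N i j n (e : i + j = n) (x : T i) (y : T j),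
  y \in F N j -> dmul e x y \in F N n.
Hypothesis F_mulS : forall N i j n (e : i + j = n) (x : T i) (y : T j),
  aug T i x = 0 -> y \in F N j -> dmul e x y \in F N.+1 n.
Hypothesis F_d : forall N i j (e : i + 1 = j) (x : T i),
  x \in F N i -> dd T e x \in F N j.
Hypothesis F_fin : forall N i, exists (n : nat) (e : 'I_n -> T i),
  forall x : T i, exists c : 'I_n -> k, x - \sum_(l < n) c l *: e l \in F N i.
(** The tower of filtration steps has pro-zero cohomology, with a shift [c] that may depend on the
    degree but not on [N]; this uniformity is what makes corrections converge. *)
Hypothesis F_prozero : forall i, exists c : nat, forall N (x : T i),
  x \in F (N + c) i -> dd T (erefl (i + 1)) x = 0 ->
  exists i' (e : i' + 1 = i) (y : T i'), y \in F N i' /\ dd T e y = x.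

Lemma F_mono m n i (x : T i) : (m <= n)%N -> x \in F n i -> x \in F m i.
Proof.
elim: n => [|n IH]; first by rewrite leqn0 => /eqP ->.
by rewrite leq_eqVlt => /orP[/eqP -> //|/IH mn] /F_decr.
Qed.

Section Truncation.
Variable N : nat.

(* Killing the degrees below [-N] forces killing the boundaries of degree
   [-N] coming from there. *)
Definition trunc_ideal i : {pred T i} := fun x =>
  `[< i < - N%:Z \/
      exists2 y, y = 0 \/ i = - N%:Z /\ bdry y & x - y \in F N.+1 i >].

Lemma trunc_submod i : submod_closed (@trunc_ideal i).
Proof.
split=> [|a u v]; first by apply/asboolP; right; exists 0;
  rewrite ?subr0 ?rpred0 //; left.
move=> /asboolP[iN|[y yP uy]]; first by move=> _; apply/asboolP; left.
move=> /asboolP[iN|[z zP vz]]; first by apply/asboolP; left.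
apply/asboolP; right; exists (a *: y + z); last first.
  by rewrite opprD addrACA -scalerBr rpredD // rpredZ.
case: yP zP => [->|[iN by_]]; rewrite ?scaler0 ?add0r // => -[->|[iN' bz]].
  by rewrite addr0; right; split=> //; apply: bdryZ.
by right; split=> //; apply: bdryD => //; apply: bdryZ.
Qed.
HB.instance Definition _ i :=
  GRing.isSubmodClosed.Build k (T i) (@trunc_ideal i) (trunc_submod i).

Definition trunc i : submodClosed (T i) := @trunc_ideal i.

Lemma truncP i (x : T i) : x \in trunc i <-> (i < - N%:Z \/
  exists2 y, y = 0 \/ i = - N%:Z /\ bdry y & x - y \in F N.+1 i).
Proof. by split=> /asboolP. Qed.

Lemma trunc_F i (x : T i) : x \in F N.+1 i -> x \in trunc i.
Proof. by move=> xF; apply/truncP; right; exists 0; [left|rewrite subr0]. Qed.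

Lemma F_trunc i (x : T i) : - N%:Z < i -> x \in trunc i -> x \in F N.+1 i.
Proof.
move=> iN /truncP[iN'|[y [->|[iN' _]]]]; rewrite ?subr0 //; exfalso; lia.
Qed.

(** A factor of negative degree moves degree [- N] below [- N], where everything is killed; a factor
    of degree 0 is a cocycle, so it preserves boundaries. *)
Lemma trunc_mull i j n (e : i + j = n) (x : T i) (y : T j) :
  x \in trunc i -> dmul e x y \in trunc n.
Proof.
have [j_gt0|j_le0] := ltP 0 j.
  by rewrite (nonpos j_gt0 y) dmul0r rpred0.
move=> /truncP[iN|[z [->|[iN bz]] xz]]; first by apply/truncP; left; lia.
  by apply/trunc_F/F_mull; rewrite -[x]subr0.
have [j_lt0|j_ge0] := ltP j 0; first by apply/truncP; left; lia.
have j0 : j = 0 by lia.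
subst j; apply/truncP; right; exists (dmul e z y).
  by right; split; [lia|apply: bdry_mull; rewrite ?deg0_cocycle].
by rewrite -dmulBl F_mull.
Qed.

Lemma trunc_mulr i j n (e : i + j = n) (x : T i) (y : T j) :
  y \in trunc j -> dmul e x y \in trunc n.
Proof.
have [i_gt0|i_le0] := ltP 0 i.
  by rewrite (nonpos i_gt0 x) dmul0l rpred0.
move=> /truncP[jN|[z [->|[jN bz]] yz]]; first by apply/truncP; left; lia.
  by apply/trunc_F/F_mulr; rewrite -[y]subr0.
have [i_lt0|i_ge0] := ltP i 0; first by apply/truncP; left; lia.
have i0 : i = 0 by lia.
subst i; apply/truncP; right; exists (dmul e x z).
  by right; split; [lia|apply: bdry_mulr; rewrite ?deg0_cocycle].
by rewrite -dmulBr F_mulr.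
Qed.

Lemma trunc_d i j (e : i + 1 = j) (x : T i) :
  x \in trunc i -> dd T e x \in trunc j.
Proof.
move=> /truncP[iN|[z [->|[iN bz]] xz]].
- have [jN|jN] := ltP j (- N%:Z); first by apply/truncP; left.
  apply/truncP; right; exists (dd T e x); last by rewrite subrr rpred0.
  by right; split; [lia|exists i, e, x].
- by apply/trunc_F/F_d; rewrite -[x]subr0.
- apply/trunc_F; rewrite -[dd T e x]subr0 -(bdry_cocycle e bz) -linearB.
  exact: F_d.
Qed.

Lemma trunc_aug i (x : T i) : x \in trunc i -> aug T i x = 0.
Proof.
move=> /truncP[iN|[z zP xz]]; first by apply: aug_deg; lia.
have : aug T i (x - z) = 0 by apply/F_aug/(F_mono _ xz).
rewrite linearB /=; case: zP => [->|[_ /aug_bdry ->]];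
  rewrite ?linear0 subr0 //.
Qed.

Definition trunc_quot : npDga k :=
  quot_npDga trunc_mull trunc_mulr trunc_d trunc_aug.
Definition trunc_proj : dgaHom T trunc_quot :=
  quot_proj trunc_mull trunc_mulr trunc_d trunc_aug.

Lemma trunc_proj_eq i (x y : T i) :
  trunc_proj i x = trunc_proj i y <-> x - y \in trunc i.
Proof. exact: qpi_eq. Qed.

Lemma trunc_proj_eq0 i (x : T i) : trunc_proj i x = 0 <-> x \in trunc i.
Proof. by rewrite -(linear0 (trunc_proj i)) trunc_proj_eq subr0. Qed.

Lemma trunc_proj_surj i (u : trunc_quot i) : exists x, trunc_proj i x = u.
Proof. exact: qpi_surj. Qed.

(** Only degrees from [- N] to 0 survive. Elements of the [N.+1]-st power of the augmentation ideal
    lift to [F N.+1] by [F_mulS], hence vanish. *)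
Lemma trunc_quot_artinian : artinian_local trunc_quot.
Proof.
split; [split=> [i|]|].
- have [n [e eP]] := F_fin N.+1 i.
  exists n, (fun l => trunc_proj i (e l)) => u.
  have [x <-] := trunc_proj_surj u; have [c xc] := eP x.
  exists c; under eq_bigr => l _ do rewrite -linearZ.
  by rewrite -linear_sum; apply/trunc_proj_eq/trunc_F.
- exists N => i iN u; have [x <-] := trunc_proj_surj u; apply/trunc_proj_eq0.
  have [i_gt0|i_le0] := ltP 0 i; first by rewrite (nonpos i_gt0 x) rpred0.
  by apply/truncP; left; lia.
exists N.+1 => i u uP.
suff [x <- xF] : exists2 x, trunc_proj i x = u & x \in F N.+1 i.
  exact/trunc_proj_eq0/trunc_F.
elim: uP => {i u} [i u|n i j l e u v u0 _ [y <- yF]|n i|n i u v _ [x <- xF] _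
  [y <- yF]].
- by have [x <-] := trunc_proj_surj u; exists x => //; apply: F0.
- have [x xE] := trunc_proj_surj u; move: u0; rewrite -xE hom_aug => x0.
  by exists (dmul e x y); [rewrite homM|apply: F_mulS].
- by exists 0; rewrite ?linear0 ?rpred0.
- by exists (x + y); rewrite ?linearD ?rpredD.
Qed.

End Truncation.

(** For [b < a] the extra boundaries in [trunc a] sit in degree [- a], below [- b], where [trunc b]
    is everything. *)
Lemma trunc_mono a b i (x : T i) : (b <= a)%N -> x \in trunc a i ->
  x \in trunc b i.
Proof.
move=> ba xa; have [iN|iN] := ltP i (- b%:Z); first by apply/truncP; left.
have [ab|ab] := eqVneq a b; first by subst a.
by apply/trunc_F/(@F_mono _ a.+1) => //; apply: F_trunc => //; lia.
Qed.

Fact trunc_trans_subproof a b (ba : (b <= a)%N) i (x : T i) :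
  x \in trunc a i -> trunc_proj b i x = 0.
Proof. by move=> xa; apply/trunc_proj_eq0; apply: trunc_mono xa. Qed.

Definition trunc_trans a b (ba : (b <= a)%N) :
  dgaHom (trunc_quot a) (trunc_quot b) :=
  quot_lift (trunc_mull (N := a)) (trunc_mulr (N := a)) (trunc_d (N := a))
    (trunc_aug (N := a)) (trunc_trans_subproof ba).

Lemma trunc_transE a b (ba : (b <= a)%N) i (x : T i) :
  trunc_trans ba i (trunc_proj a i x) = trunc_proj b i x.
Proof. exact: (quot_liftE (trunc_trans_subproof ba)). Qed.

Program Definition trunc_diagram : npDiagram k nat_op :=
  @NpDiagram k nat_op trunc_quot (fun a b f => trunc_trans f) _ _.
Next Obligation.
by have [y <-] := trunc_proj_surj x; apply: trunc_transE.
Qed.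
Next Obligation.
have [y <-] := trunc_proj_surj x;
  apply: (etrans (trunc_transE (leq_trans f g) y)).
apply/esym/(etrans (congr1 (trunc_trans f i) (trunc_transE g y))).
exact: trunc_transE.
Qed.

Definition trunc_pro : proArtinian k :=
  ProArtinian nat_op_cofiltered trunc_quot_artinian (pro_diagram :=
    trunc_diagram).

Lemma trunc_cone : is_cone (D := trunc_diagram) trunc_proj.
Proof. by move=> a b f i x; apply: trunc_transE. Qed.

Definition completion : npDga k := lim_npDga trunc_diagram nat_op_cofiltered.
Definition complete : dgaHom T completion :=
  lim_lift nat_op_cofiltered trunc_cone.

Lemma F_prozero_at i' i (e : i' + 1 = i) : exists c : nat, forall N (x : T i),
  x \in F (N + c) i -> dd T (erefl (i + 1)) x = 0 ->
  exists2 y : T i', y \in F N i' & dd T e y = x.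
Proof.
have [c cP] := F_prozero i; exists c => N x xF xc.
have [i2 [e2 [y [yF yx]]]] := cP N x xF xc.
have i2E : i2 = i' by lia.
by subst i2; exists y; rewrite -?yx; last exact: dd_irr.
Qed.

(** One deep component of the bounding element suffices: lifted to T, it bounds [x] up to a cocycle
    of [F c], and that is a boundary. *)
Lemma complete_inj j (x : T j) : dd T (erefl (j + 1)) x = 0 ->
  bdry (complete j x) -> bdry x.
Proof.
move=> xc [i [e [E Ex]]].
(* [N] is at least [c] and exceeds the absolute value of [j], so that in degree [j] the truncation
   ideal is just [F N.+1]. *)
have [c cP] := F_prozero_at e; pose N := (c + `|j|.+1)%N.
have [y yE] := trunc_proj_surj (E N).
have xy : x - dd T e y \in F (0 + c) j.
  apply: (@F_mono _ N.+1); first by rewrite /N; lia.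
  apply: F_trunc; first by rewrite /N; lia.
  apply/trunc_proj_eq; rewrite homd yE.
  exact/esym/(congr1 (fun z : lim_comp trunc_diagram j => z N) Ex).
have [|w _ wE] := cP 0%N _ xy; first by rewrite linearB /= xc ddd subrr.
by exists i, e, (y + w); rewrite linearD /= wE addrC subrK.
Qed.

Lemma F_telescope i (t : nat -> T i) a b : (a <= b)%N ->
  (forall n, t n.+1 - t n \in F n i) -> t b - t a \in F a i.
Proof.
move=> ab tF; elim: b ab => [|b IH].
  by rewrite leqn0 => /eqP ->; rewrite subrr rpred0.
rewrite leq_eqVlt => /orP[/eqP ->|ab]; first by rewrite subrr rpred0.
by rewrite -(subrKA (t b)) rpredD ?IH // (F_mono _ (tF b)).
Qed.

(* A cocycle of the completion is a sequence of approximate cocycles [t n];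
   pro-vanishing corrects them to cocycles [u n], then to cohomologous ones,
   and the correcting terms [e n] form a convergent series. *)
Lemma complete_surj j (z : completion j) :
  dd completion (erefl (j + 1)) z = 0 ->
  exists2 x : T j, dd T (erefl (j + 1)) x = 0 & bdry (complete j x - z).
Proof.
move=> zc.
pose t0 n := projT1 (cid (trunc_proj_surj (z n))).
have t0P n : trunc_proj n j (t0 n) = z n by rewrite /t0; case: cid.
(* The shift keeps degrees [j] and [j + 1] above the truncation, where the ideals are filtration
   steps. *)
pose N0 := `|j|.+2; pose t n := t0 (n + N0)%N.
have tz n m : (n <= m)%N -> trunc_proj n j (t m) = z n.
  move=> nm; have nm' : (n <= m + N0)%N by lia.
  by rewrite -(trunc_transE nm') t0P;
    apply: (lvalP z (nm' : @mor nat_op (m + N0)%N n)).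
have dtF n : dd T (erefl (j + 1)) (t n) \in F n (j + 1).
  apply: (@F_mono _ (n + N0).+1); first by lia.
  apply: F_trunc; first by rewrite /N0; lia.
  apply/trunc_proj_eq0; rewrite homd t0P.
  exact: (congr1 (fun y : lim_comp trunc_diagram (j + 1) => y (n + N0)%N) zc).
have tF n : t n.+1 - t n \in F n j.
  apply: (@F_mono _ (n + N0).+1); first by lia.
  apply: F_trunc; first by rewrite /N0; lia.
  apply/trunc_proj_eq; rewrite t0P.
  have nn : (n + N0 <= n.+1 + N0)%N by lia.
  by rewrite -(trunc_transE nn) t0P;
    apply: (lvalP z (nn : @mor nat_op (n.+1 + N0)%N (n + N0)%N)).
have [c1 c1P] := F_prozero_at (erefl (j + 1)).
have sP n : exists s, s \in F n j /\
    dd T (erefl (j + 1)) s = dd T (erefl (j + 1)) (t (n + c1)%N).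
  by have [|y yF yE] := c1P n _ (dtF (n + c1)%N); [apply: ddd|exists y].
pose s n := projT1 (cid (sP n)).
have sF n : s n \in F n j by rewrite /s; case: cid => ? [].
pose u n := t (n + c1)%N - s n.
have uc n : dd T (erefl (j + 1)) (u n) = 0.
  by rewrite linearB /= /s; case: cid => ? [_ /= ->]; rewrite subrr.
have utF n : u n - t n \in F n j.
  by rewrite /u addrAC submodB // F_telescope // leq_addr.
have uF n : u n.+1 - u n \in F n j.
  rewrite -(subrKA (t n.+1)) rpredD ?(F_decr (utF _)) //.
  rewrite -(subrKA (t n)) rpredD //.
  by rewrite -opprB submodN.
(* While [c1] came from degree [j + 1] to correct the differentials, [c0] comes from degree [j] and
   bounds the differences of successive cocycles. *)
have [c0 c0P] := F_prozero_at (subrK 1 j).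
have eP n : exists e, e \in F n (j - 1) /\
    dd T (subrK 1 j) e = u (n + c0).+1 - u (n + c0)%N.
  have [|y yF yE] := c0P n _ (uF (n + c0)%N); last by exists y.
  by rewrite linearB /= !uc subrr.
pose e n := projT1 (cid (eP n)).
have eF n : e n \in F n (j - 1) by rewrite /e; case: cid => ? [].
have de n : dd T (subrK 1 j) (e n) = u (n + c0).+1 - u (n + c0)%N.
  by rewrite /e; case: cid => ? [].
pose E n := \sum_(i < n) e i.
have EF n : E n.+1 - E n \in F n (j - 1).
  by rewrite /E big_ord_recr /= addrAC subrr add0r.
have dE n : dd T (subrK 1 j) (E n) = u (n + c0)%N - u c0.
  elim: n => [|n IH]; first by rewrite /E big_ord0 linear0 subrr.
  by rewrite /E big_ord_recr linearD /= -/(E n) IH de addrC addrA subrK.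
(* Component [a] is the partial sum up to [a.+1]: all later terms lie in [F a.+1], which [trunc a]
   kills. *)
have Ecomp (a b : nat_op) (f : mor a b) :
    dmor trunc_diagram f (j - 1) (trunc_proj a _ (E a.+1)) =
      trunc_proj b _ (E b.+1).
  rewrite [LHS]trunc_transE; apply/trunc_proj_eq/trunc_F/F_telescope => //.
exists (u c0) => //; exists (j - 1), (subrK 1 j), (- LimComp Ecomp).
apply: lim_ext => n.
suff dEn : dd (trunc_quot n) (subrK 1 j) (- trunc_proj n _ (E n.+1)) =
    trunc_proj n j (u c0) - z n by exact: dEn.
rewrite linearN -homd dE linearB opprB; congr (_ - _).
rewrite -(tz n n.+1) //; apply/trunc_proj_eq/trunc_F.
rewrite -(subrKA (u n.+1)) rpredD //; apply: F_telescope => //; exact: leq_addr.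
Qed.

Lemma complete_quasi_iso : quasi_iso_map complete.
Proof. exact: quasi_iso_intro complete_surj complete_inj. Qed.

Lemma quasi_isomorphic_limit_of_filtration :
  exists (P : proArtinian k) (L : npDga k)
    (p : forall a : pro_index P, dgaHom L (P a)),
    is_limit p /\ quasi_isomorphic T L.
Proof.
exists trunc_pro, completion, (lim_proj trunc_diagram nat_op_cofiltered).
split; first exact: lim_is_limit.
by apply: rst_step; exists complete; apply: complete_quasi_iso.
Qed.

End Filtration.

(** * Free algebras *)

(* A presentation of the free associative algebra by its monomial basis; using
   it abstractly keeps the construction of the product from being unfolded. *)
Record free_algebra (k : fieldType) (L : choiceType) := FreeAlgebra {
  fa_alg :> algType k;
  mono : seq L -> fa_alg;
  coef : seq L -> {scalar fa_alg};
  fsupp : fa_alg -> seq (seq L);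
  mono_nil : mono [::] = 1;
  mono_cat : forall u v, mono (u ++ v) = mono u * mono v;
  coef_mono : forall u w, coef u (mono w) = (w == u)%:R;
  mono_sum : forall f, f = \sum_(w <- fsupp f) coef w f *: mono w;
  mem_fsupp : forall f w, (w \in fsupp f) = (coef w f != 0);
  fsupp_uniq : forall f, uniq (fsupp f)
}.

Module MalgModel.
Import finmap monalg.

Definition word (L : choiceType) := seq L.
HB.instance Definition _ (L : choiceType) := Choice.on (word L).

Lemma cat_nil_inv (L : choiceType) (u v : word L) :
  u ++ v = [::] -> u = [::] /\ v = [::].
Proof. by case: u v => [|? ?] [|? ?]. Qed.
HB.instance Definition _ (L : choiceType) :=
  Choice_isMonomialDef.Build (word L) (@catA L) (@cat0s L) (@cats0 L)
    (@cat_nil_inv L).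

Section FreeAlgebraExists.
Variables (k : fieldType) (L : choiceType).
Local Notation FA := {malg k[word L]}.

Lemma malgUE c w : << c *g w >> = c *: << w >> :> FA.
Proof. by apply/malgP => u; rewrite mcoeffZ !mcoeffU mulrnAr mulr1. Qed.

Lemma malg_sum (f : FA) : f = \sum_(w <- msupp f) f@_w *: << w >>.
Proof. by rewrite {1}[f]monalgE; apply: eq_bigr => w _; apply: malgUE. Qed.

Lemma malgUM u v : << u >> * << v >> = << (u ++ v : word L) >> :> FA.
Proof. by rewrite malgM_def fgmulUU mulr1. Qed.

Lemma malg_scalerAr c (f g : FA) : c *: (f * g) = f * (c *: g).
Proof.
rewrite [f]malg_sum !mulr_suml scaler_sumr; apply: eq_bigr => w _.
rewrite -!scalerAl scalerA mulrC -scalerA; congr (_ *: _).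
rewrite [g]malg_sum mulr_sumr !scaler_sumr mulr_sumr; apply: eq_bigr => u _.
rewrite scalerA -!malgUE !malgM_def !fgmulUU !mul1r.
by rewrite malgUE [RHS]malgUE scalerA.
Qed.

(* [{malg _}] is canonically an algebra only over a commutative monoid. *)
Definition malg_word := FA.
HB.instance Definition _ := GRing.Lalgebra.copy malg_word FA.
HB.instance Definition _ :=
  GRing.Lalgebra_isAlgebra.Build k malg_word malg_scalerAr.

Lemma mcoeff_scalar (w : word L) : scalar (@mcoeff (word L) k w).
Proof. by move=> c f g; rewrite mcoeffD mcoeffZ. Qed.

Lemma free_algebra_exists : inhabited (free_algebra k L).
Proof.
constructor.
apply: (@FreeAlgebra k L malg_word (fun w : word L => << w >>)
  (fun w => mk_scalar (@mcoeff_scalar w)) (fun f => enum_fset (msupp f))) => /=.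
- by [].
- by move=> u v; rewrite malgUM.
- by move=> u w; rewrite mcoeffU1.
- exact: malg_sum.
- by move=> f w; rewrite mcoeff_neq0.
- by move=> f; apply: fset_uniq.
Qed.

End FreeAlgebraExists.
End MalgModel.

Section FreeAlgebra.
Variables (k : fieldType) (L : choiceType) (FA : free_algebra k L).
Local Notation mono := (mono FA).

Lemma coefP (f g : FA) : (forall w, coef FA w f = coef FA w g) -> f = g.
Proof.
move=> fg; rewrite [f]mono_sum [g]mono_sum.
rewrite (perm_big (fsupp g)) /=; first by apply: eq_bigr => w _; rewrite fg.
by apply: uniq_perm; rewrite ?fsupp_uniq // => w; rewrite !mem_fsupp fg.
Qed.

(** Degree, word length and admissible letters are all conditions on the words that occur, so one
    predicate handles grading, filtration and subalgebras alike. *)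
Definition supp (P : pred (seq L)) : {pred FA} := fun f => all P (fsupp f).

Lemma suppP (P : pred (seq L)) f :
  reflect (forall w, coef FA w f != 0 -> P w) (f \in supp P).
Proof.
apply: (iffP allP) => [fP w|fP w]; last by rewrite mem_fsupp; apply: fP.
by rewrite -mem_fsupp; apply: fP.
Qed.

Lemma supp_submod P : submod_closed (supp P).
Proof.
split=> [|c f g /suppP fP /suppP gP]; first by apply/suppP => w;
  rewrite linear0 eqxx.
apply/suppP => w; rewrite linearP /=.
have [-> |f0 _] := eqVneq (coef FA w f) 0; last exact: fP.
by rewrite mulr0 add0r; apply: gP.
Qed.
HB.instance Definition _ P :=
  GRing.isSubmodClosed.Build k FA (supp P) (supp_submod P).

Lemma suppS (P Q : pred (seq L)) f :
  (forall w, P w -> Q w) -> f \in supp P -> f \in supp Q.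
Proof. by move=> PQ /suppP fP; apply/suppP => w /fP/PQ. Qed.

Lemma suppI (P Q : pred (seq L)) f :
  f \in supp P -> f \in supp Q -> f \in supp (fun w => P w && Q w).
Proof.
by move=> /suppP fP /suppP fQ; apply/suppP => w w0; rewrite fP ?fQ.
Qed.

Lemma supp_mono (P : pred (seq L)) w : P w -> mono w \in supp P.
Proof.
move=> Pw; apply/suppP => u; rewrite coef_mono.
by case: (w =P u) => [<-|]; rewrite // eqxx.
Qed.

Lemma supp_ind (P : pred (seq L)) (C : FA -> Prop) :
  C 0 -> (forall f g, C f -> C g -> C (f + g)) ->
  (forall c f, C f -> C (c *: f)) -> (forall w, P w -> C (mono w)) ->
  forall f, f \in supp P -> C f.
Proof.
move=> C0 CD CZ CP f /allP fP; rewrite [f]mono_sum big_seq.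
by elim/big_ind: _ => // w wf; apply/CZ/CP/fP.
Qed.

Lemma supp_true f : f \in supp predT.
Proof. by apply/suppP. Qed.

Lemma suppM (P Q R : pred (seq L)) f g :
  (forall u v, P u -> Q v -> R (u ++ v)) ->
  f \in supp P -> g \in supp Q -> f * g \in supp R.
Proof.
move=> PQR fP gQ; move: f fP; apply: supp_ind => [|f1 f2 h1 h2|c f h|u Pu].
- by rewrite mul0r rpred0.
- by rewrite mulrDl rpredD.
- by rewrite -scalerAl rpredZ.
move: g gQ; apply: supp_ind => [|f1 f2 h1 h2|c f h|v Qv].
- by rewrite mulr0 rpred0.
- by rewrite mulrDr rpredD.
- by rewrite -scalerAr rpredZ.
by rewrite -mono_cat supp_mono // PQR.
Qed.

Section LinearExtension.
Variables (V : lmodType k) (g : seq L -> V).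

Definition lext (f : FA) : V := \sum_(w <- fsupp f) coef FA w f *: g w.

Lemma lextEw (E : seq (seq L)) f : uniq E -> {subset fsupp f <= E} ->
  lext f = \sum_(w <- E) coef FA w f *: g w.
Proof.
move=> uE fE; rewrite [RHS](bigID (fun w => w \in fsupp f)) /=.
rewrite [X in _ + X]big1 ?addr0 => [|w]; last first.
  by rewrite mem_fsupp negbK => /eqP ->; rewrite scale0r.
rewrite -big_filter; apply: perm_big; apply: uniq_perm.
- exact: fsupp_uniq.
- exact: filter_uniq.
- by move=> w; rewrite mem_filter andb_idr //; apply: fE.
Qed.

Lemma lext_linear : linear lext.
Proof.
move=> c f h; pose E := undup (fsupp f ++ fsupp h ++ fsupp (c *: f + h)).
have [fE hE cE] : [/\ {subset fsupp f <= E}, {subset fsupp h <= E} &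
    {subset fsupp (c *: f + h) <= E}].
  by split=> w wS; rewrite mem_undup !mem_cat wS ?orbT.
have uE : uniq E by apply: undup_uniq.
rewrite (lextEw uE fE) (lextEw uE hE) (lextEw uE cE).
rewrite scaler_sumr -big_split /=; apply: eq_bigr => w _.
by rewrite linearP scalerDl scalerA.
Qed.
HB.instance Definition _ := GRing.isLinear.Build k FA V _ lext lext_linear.

Lemma lext_mono w : lext (mono w) = g w.
Proof.
rewrite (@lextEw [:: w]) //; first by rewrite big_seq1 coef_mono eqxx scale1r.
move=> u; rewrite mem_fsupp coef_mono inE.
by case: (w =P u) => [->|_]; rewrite ?eqxx.
Qed.

End LinearExtension.

(** The cofactor of the prefix [v]. Words of a fixed length are a basis of the right ideal they
    generate, as a right module, and [lquo] gives the coordinates in it. *)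
Definition lquo (v : seq L) : FA -> FA :=
  lext (fun w => if prefix v w then mono (drop (size v) w) else 0).
HB.instance Definition _ v := GRing.Linear.copy (lquo v)
  (lext (fun w => if prefix v w then mono (drop (size v) w) else 0)).

Lemma lquo_mono v w :
  lquo v (mono w) = if prefix v w then mono (drop (size v) w) else 0.
Proof. exact: lext_mono. Qed.

Lemma supp_lquo (P Q : pred (seq L)) v f :
  (forall w, P (v ++ w) -> Q w) -> f \in supp P -> lquo v f \in supp Q.
Proof.
move=> PQ; move: f; apply: supp_ind => [|g h gQ hQ|c g gQ|w wP].
- by rewrite linear0 rpred0.
- by rewrite linearD rpredD.
- by rewrite linearZ rpredZ.
rewrite lquo_mono; case: ifP => [/prefixP[u wE]|_]; last exact: rpred0.
by apply: supp_mono; apply: PQ; rewrite wE drop_size_cat -?wE.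
Qed.

Lemma lquo_mul_mono v u f : size u = size v ->
  lquo v (mono u * f) = if u == v then f else 0.
Proof.
move=> uv; move: f (supp_true f); apply: supp_ind => [|g h gQ hQ|c g gQ|w _].
- by rewrite mulr0 linear0 if_same.
- by rewrite mulrDr linearD /= gQ hQ; case: ifP; rewrite ?addr0.
- by rewrite -scalerAr linearZ /= gQ; case: ifP; rewrite ?scaler0.
rewrite -mono_cat lquo_mono prefixE -uv take_size_cat //.
by rewrite drop_size_cat.
Qed.

Lemma lquo_mul_supp (P : pred (seq L)) v f g :
  (forall w, P w -> (size v <= size w)%N && ~~ prefix v w) ->
  f \in supp P -> lquo v (f * g) = 0.
Proof.
move=> Pv; move: f; apply: supp_ind => [|f1 f2 h1 h2|c f1 h1|u Pu].
- by rewrite mul0r linear0.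
- by rewrite mulrDl linearD /= h1 h2 addr0.
- by rewrite -scalerAl linearZ /= h1 scaler0.
have /andP[vu vu'] := Pv u Pu.
move: g (supp_true g); apply: supp_ind => [|f1 f2 h1 h2|c f1 h1|w _].
- by rewrite mulr0 linear0.
- by rewrite mulrDr linearD /= h1 h2 addr0.
- by rewrite -scalerAr linearZ /= h1 scaler0.
rewrite -mono_cat lquo_mono ifN //; apply: contra vu'.
by rewrite !prefixE takel_cat.
Qed.

Lemma lquo_sum N (V : seq (seq L)) f : uniq V ->
  f \in supp (fun w => take N w \in V) -> {in V, forall v, size v = N} ->
  f = \sum_(v <- V) mono v * lquo v f.
Proof.
move=> uV fV sV; move: f fV; apply: supp_ind => [|f g fE gE|c f fE|w wV].
- by rewrite big1 // => v _; rewrite linear0 mulr0.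
- under eq_bigr => v _ do rewrite linearD mulrDr.
  by rewrite big_split /= -fE -gE.
- under eq_bigr => v _ do rewrite linearZ /= -scalerAr.
  by rewrite -scaler_sumr -fE.
rewrite (bigD1_seq (take N w)) //= big_seq_cond big1 ?addr0 =>
  [|v /andP[vV vN]].
  by rewrite lquo_mono prefix_take -mono_cat sV // cat_take_drop.
by rewrite lquo_mono prefixE sV // eq_sym (negPf vN) mulr0.
Qed.

Lemma coef_nilM f g :
  coef FA [::] (f * g) = coef FA [::] f * coef FA [::] g.
Proof.
move: f (supp_true f); apply: supp_ind => [|f1 f2 h1 h2|c f h|u _].
- by rewrite mul0r linear0 mul0r.
- by rewrite mulrDl 2!linearD /= h1 h2 mulrDl.
- by rewrite -scalerAl 2!linearZ /= h mulrA.
move: g (supp_true g); apply: supp_ind => [|f1 f2 h1 h2|c f h|v _].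
- by rewrite mulr0 linear0 mulr0.
- by rewrite mulrDr 2!linearD /= h1 h2 mulrDr.
- by rewrite -scalerAr 2!linearZ /= h mulrCA.
by rewrite -mono_cat !coef_mono -natrM mulnb; case: u v => [|? ?] [|? ?].
Qed.

End FreeAlgebra.

(** * Derivations of free algebras *)

Section Derivation.
Variables (k : fieldType) (L : choiceType) (FA : free_algebra k L) (deg : L ->
  nat).
Local Notation mono := (mono FA).

(** The weight is minus the cohomological degree. *)
Definition wt (w : seq L) : nat := sumn [seq deg x | x <- w].

Lemma wt_cons x w : wt (x :: w) = (deg x + wt w)%N. Proof. by []. Qed.

Lemma wt_cat u v : wt (u ++ v) = (wt u + wt v)%N.
Proof. by rewrite /wt map_cat sumn_cat. Qed.

Lemma wt_take n w : (wt (take n w) <= wt w)%N.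
Proof. by rewrite -{2}(cat_take_drop n w) wt_cat leq_addr. Qed.

(** The Koszul sign as a linear operator, so that the Leibniz rule [derM] holds for inhomogeneous
    elements. *)
Definition sgn : FA -> FA := lext (fun w => (-1) ^+ wt w *: mono w).
HB.instance Definition _ := GRing.Linear.copy sgn
  (lext (fun w => (-1) ^+ wt w *: mono w)).

Lemma sgn_supp n f : f \in supp (fun w => wt w == n) -> sgn f = (-1) ^+ n *: f.
Proof.
move: f; apply: supp_ind => [|f g fE gE|c f fE|w /eqP wn].
- by rewrite linear0 scaler0.
- by rewrite linearD /= fE gE scalerDr.
- by rewrite linearZ /= fE !scalerA mulrC.
- by rewrite /sgn lext_mono wn.
Qed.

Variable D : L -> FA.

Fixpoint dword (w : seq L) : FA :=
  if w is x :: u then D x * mono u + (-1) ^+ deg x *: (mono [:: x] * dword u)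
  else 0.

Definition der : FA -> FA := lext dword.
HB.instance Definition _ := GRing.Linear.copy der (lext dword).

Lemma der_mono w : der (mono w) = dword w.
Proof. exact: lext_mono. Qed.

Lemma der1 : der 1 = 0. Proof. by rewrite -(mono_nil FA) der_mono. Qed.

Lemma der_letter x : der (mono [:: x]) = D x.
Proof. by rewrite der_mono /= mulr0 scaler0 addr0 mono_nil mulr1. Qed.

Lemma der_mono_cat u v : der (mono (u ++ v)) =
  der (mono u) * mono v + (-1) ^+ wt u *: (mono u * der (mono v)).
Proof.
rewrite !der_mono; elim: u => [|x u IH].
  by rewrite mul0r add0r mono_nil mul1r scale1r.
rewrite /= IH mono_cat wt_cons exprD -scalerA -[x :: u]cat1s mono_cat.
rewrite mulrDl mulrA -addrA -scalerAl -scalerDr mulrDr -scalerAr.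
by rewrite 2!mulrA.
Qed.

Lemma derM f g : der (f * g) = der f * g + sgn f * der g.
Proof.
move: f (supp_true f); apply: supp_ind => [|f1 f2 h1 h2|c f h|u _].
- by rewrite !(mul0r, linear0) add0r.
- by rewrite mulrDl 3!linearD /= h1 h2 2!mulrDl addrACA.
- by rewrite -scalerAl 3!linearZ /= h scalerDr 2!scalerAl.
move: g (supp_true g); apply: supp_ind => [|g1 g2 h1 h2|c g h|v _].
- by rewrite !(mulr0, linear0) add0r.
- by rewrite mulrDr 2!linearD /= h1 h2 2!mulrDr addrACA.
- by rewrite -scalerAr 2!linearZ /= h scalerDr -2!scalerAr.
by rewrite -mono_cat der_mono_cat /sgn lext_mono -scalerAl.
Qed.

Hypothesis D_wt : forall x, D x \in supp (fun w => (wt w).+1 == deg x).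

Lemma dword_wt w : dword w \in supp (fun u => (wt u).+1 == wt w).
Proof.
elim: w => [|x w IH]; first exact: rpred0.
rewrite /= rpredD ?rpredZ //.
  apply: suppM (D_wt x) (supp_mono _ (eqxx w)) => u v /eqP ux /eqP <-.
  by rewrite wt_cat wt_cons -ux addSn.
apply: suppM (supp_mono _ (eqxx [:: x])) IH => u v /eqP <- /eqP vw.
by rewrite wt_cat 2!wt_cons addn0 -vw addnS.
Qed.

Lemma der_wt n f : f \in supp (fun w => wt w == n) ->
  der f \in supp (fun w => (wt w).+1 == n).
Proof.
move: f; apply: supp_ind => [|f g fn gn|c f fn|w /eqP <-].
- by rewrite linear0 rpred0.
- by rewrite linearD rpredD.
- by rewrite linearZ rpredZ.
- by rewrite der_mono dword_wt.
Qed.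

(** On a word, the two mixed terms of the Leibniz rule cancel because [D x] has weight one less than
    [x]. A letter of weight 0 has [D x = 0], as no word has weight -1. *)
Lemma der_der : (forall x, der (D x) = 0) -> forall f, der (der f) = 0.
Proof.
move=> dD f; move: f (supp_true f).
apply: supp_ind => [|f g fn gn|c f fn|w _].
- by rewrite !linear0.
- by rewrite !linearD /= fn gn addr0.
- by rewrite !linearZ /= fn scaler0.
elim: w => [|x w IH]; first by rewrite mono_nil der1 linear0.
rewrite der_mono /= linearD linearZ /= !derM dD mul0r add0r -(der_mono w) IH.
rewrite mulr0 addr0 der_letter.
have [x0|x_gt0] := posnP (deg x).
  suff -> : D x = 0 by rewrite linear0 !mul0r scaler0 addr0.
  by apply: coefP => u; apply: contrapT => /eqP;
    rewrite linear0 => /(suppP _ _ (D_wt x)); rewrite x0.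
rewrite (@sgn_supp (deg x).-1).
  by rewrite -scalerAl -scalerDl -{2}(prednK x_gt0) exprS mulN1r subrr scale0r.
by apply: suppS (D_wt x) => u; rewrite -(prednK x_gt0).
Qed.

Hypothesis D_size : forall x, D x \in supp (fun w => (0 < size w)%N).

Lemma dword_size w : dword w \in supp (fun u => (size w <= size u)%N).
Proof.
elim: w => [|x w IH]; first exact: rpred0.
rewrite /= rpredD ?rpredZ //.
  apply: suppM (D_size x) (supp_mono _ (eqxx w)) => u v ux /eqP <-.
  by rewrite size_cat -addn1 addnC leq_add2r.
apply: suppM (supp_mono _ (eqxx [:: x])) IH => u v /eqP <- vw.
by rewrite size_cat.
Qed.

Lemma der_size n f : f \in supp (fun w => (n <= size w)%N) ->
  der f \in supp (fun w => (n <= size w)%N).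
Proof.
move: f; apply: supp_ind => [|f g fn gn|c f fn|w nw].
- by rewrite linear0 rpred0.
- by rewrite linearD rpredD.
- by rewrite linearZ rpredZ.
by rewrite der_mono; apply: suppS (dword_size w) => u; apply: leq_trans.
Qed.

Variable ok : pred L.
Hypothesis D_ok : forall x, D x \in supp (all ok).

Lemma dword_ok w : all ok w -> dword w \in supp (all ok).
Proof.
elim: w => [|x w IH]; first by move=> _; apply: rpred0.
move=> /andP[okx okw]; rewrite /= rpredD ?rpredZ //.
  apply: (@suppM _ _ _ (all ok) (all ok)) (D_ok x) (supp_mono _ okw) => u v.
  by rewrite all_cat => -> ->.
apply: (@suppM _ _ _ (all ok) (all ok)) (IH okw) => [u v|].
  by rewrite all_cat => -> ->.
by apply: supp_mono; rewrite /= okx.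
Qed.

Lemma der_ok f : f \in supp (all ok) -> der f \in supp (all ok).
Proof.
move: f; apply: supp_ind => [|f g fn gn|c f fn|w nw].
- by rewrite linear0 rpred0.
- by rewrite linearD rpredD.
- by rewrite linearZ rpredZ.
by rewrite der_mono; apply: dword_ok.
Qed.

(** These words form the basis of the part of degree [- n] of [m^N], in the subalgebra on the
    letters [ok]. *)
Definition okw N n (w : seq L) := [&& all ok w, wt w == n & (N <= size w)%N].

Lemma okwS N N' n w : (N' <= N)%N -> okw N n w -> okw N' n w.
Proof. by move=> NN' /and3P[h1 h2 /(leq_trans NN') h3]; apply/and3P. Qed.

Lemma der_okw N n f : f \in supp (okw N n) ->
  der f \in supp (fun w => [&& all ok w, (wt w).+1 == n & (N <= size w)%N]).
Proof.
move=> fN; apply: suppI; last apply: suppI.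
- by apply: der_ok; apply: suppS fN => w /and3P[].
- by apply: der_wt; apply: suppS fN => w /and3P[].
- by apply: der_size; apply: suppS fN => w /and3P[].
Qed.

(** Differentiating a prefix lowers its weight without shortening it, so the prefix [v] of extremal
    weight [b] survives only in terms where the cofactor is differentiated. *)
Lemma lquo_der M b v f : size v = M -> wt v = b ->
  f \in supp (fun w => (M <= size w)%N && (wt (take M w) <= b)%N) ->
  lquo v (der f) = (-1) ^+ b *: der (lquo v f).
Proof.
move=> vM vb; move: f; apply: supp_ind => [|f g h1 h2|c f h|w /andP[Mw wb]].
- by rewrite !linear0 ?scaler0.
- by rewrite !linearD /= h1 h2.
- by rewrite !linearZ /= h !scalerA mulrC.
rewrite -[w](cat_take_drop M); set u := take M w; set t := drop M w.
have uM : size u = M by rewrite size_takel.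
rewrite mono_cat derM linearD /=.
rewrite (@lquo_mul_supp _ _ FA (fun x =>
  (size u <= size x)%N && ((wt x).+1 == wt u))).
- rewrite add0r (@sgn_supp (wt u)); last exact: supp_mono.
  rewrite -scalerAl linearZ /= !lquo_mul_mono ?uM ?vM //.
  by case: eqP => [->|_]; rewrite ?vb // !linear0 ?scaler0.
- move=> x /andP[ux /eqP xu]; rewrite vM -uM ux; apply/negP => /prefixP[y xE].
  by move: wb xu; rewrite -/u xE wt_cat vb; lia.
- by rewrite der_mono; apply: suppI; rewrite (dword_size, dword_wt).
Qed.

Hypothesis der_D : forall x, der (D x) = 0.

Variable r : nat.
Hypothesis word_bdry : forall w, all ok w -> wt w = 0 -> size w = r ->
  exists2 s, s \in supp (okw 0 1) & der s = mono w.

(* Grouping a cocycle [z] by its prefixes [v] of length [N + r], the cofactor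
   of each [v] of extremal weight [b] is a cocycle [t], by freeness. If the
   last [r] letters of [v = u w] have degree 0, then [w = d s] and
   [v t = +- d (u s t)] up to terms whose prefix of length [N] has smaller
   weight. *)
Lemma prozero_step N b n z : z \in supp (okw (N + r) n) ->
  z \in supp (fun w => (wt (take (N + r) w) <= b)%N) -> der z = 0 ->
  exists2 s, s \in supp (okw N n.+1) &
    z - der s \in supp (fun w => (wt (take N w) < b)%N).
Proof.
move=> zok zb dz0; pose M := (N + r)%N.
pose V := undup [seq take M w | w <- fsupp z].
have VP (v : seq L) : v \in V -> [/\ size v = M, all ok v & (wt v <= b)%N].
  rewrite mem_undup => /mapP[w wz ->].
  have /and3P[wok _ wM] : okw (N + r) n w by apply/(suppP _ _ zok);
    rewrite -mem_fsupp.
  rewrite size_takel //; split=> //; last by apply/(suppP _ _ zb);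
    rewrite -mem_fsupp.
  by move: wok; rewrite -{1}(cat_take_drop M w) all_cat => /andP[].
have zV : z = \sum_(v <- V) mono v * lquo v z.
  apply: (@lquo_sum _ _ FA M) => [||v /VP[]//]; first exact: undup_uniq.
  apply/allP => w wz; rewrite mem_undup; exact: map_f.
(* A prefix in [V] weighs at most [b]; if its first [N] letters already weigh [b], its last [r]
   letters have weight 0 and form a boundary by [word_bdry]. *)
pose top (v : seq L) := wt (take N v) == b.
have topP (v : seq L) : v \in V -> top v -> [/\ wt v = b, wt (drop N v) = 0,
    size (drop N v) = r & all ok (drop N v)].
  move=> /VP[vM vok vb] /eqP vN.
  have := wt_cat (take N v) (drop N v); rewrite cat_take_drop => wE.
  rewrite size_drop vM /M addKn; split=> //; [lia|lia|].
  by move: vok; rewrite -{1}(cat_take_drop N v) all_cat => /andP[].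
have sP (v : seq L) : exists s, v \in V -> top v ->
    s \in supp (okw 0 1) /\ der s = mono (drop N v).
  have [/andP[vV vt]|nv] := boolP ((v \in V) && top v).
    have [_ v0 vr vok] := topP v vV vt.
    by have [s s1 s2] := word_bdry vok v0 vr; exists s.
  by exists 0 => vV vt; move: nv; rewrite vV vt.
pose s (v : seq L) := projT1 (cid (sP v)).
have s_ok (v : seq L) : v \in V -> top v -> s v \in supp (okw 0 1).
  by rewrite /s; case: cid => ? /= h vV vt; case: (h vV vt).
have ds (v : seq L) : v \in V -> top v -> der (s v) = mono (drop N v).
  by rewrite /s; case: cid => ? /= h vV vt; case: (h vV vt).
have dl (v : seq L) : v \in V -> top v -> der (lquo v z) = 0.
  move=> vV vt; have [vb _ _ _] := topP v vV vt; have [vM _ _] := VP v vV.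
  have zMb : z \in supp (fun w => (M <= size w)%N && (wt (take M w) <= b)%N).
    by apply: suppI zb; apply: suppS zok => w /and3P[].
  have /esym/eqP := lquo_der vM vb zMb.
  by rewrite dz0 linear0 scaler_eq0 expf_eq0 oppr_eq0 oner_eq0 andbF => /eqP.
have take_N (v x : seq L) : v \in V -> take N (v ++ x) = take N v.
  by move=> /VP[vM _ _]; rewrite takel_cat // vM leq_addr.
have mono_N (v : seq L) : mono v = mono (take N v) * mono (drop N v).
  by rewrite -mono_cat cat_take_drop.
exists (\sum_(v <- V | top v)
    (-1) ^+ b *: (mono (take N v) * (s v * lquo v z))).
  rewrite big_seq_cond; apply: rpred_sum => v /andP[vV vt]; apply: rpredZ.
  have [vb v0 vr _] := topP v vV vt; have [vM vok _] := VP v vV.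
  have lz : lquo v z \in supp (fun x => all ok x && ((b + wt x)%N == n)).
    apply: supp_lquo zok => x /and3P[].
    by rewrite all_cat wt_cat vb => /andP[_ ->] ->.
  have slz : s v * lquo v z \in
      supp (fun x => all ok x && ((b + wt x)%N == n.+1)).
    apply: suppM (s_ok v vV vt) lz =>
      x y /and3P[xok /eqP x1 _] /andP[yok /eqP yn].
    by rewrite all_cat xok yok wt_cat x1 add1n addnS yn eqxx.
  have Nv : mono (take N v) \in supp (pred1 (take N v)) by rewrite supp_mono /=.
  apply: suppM Nv slz => x y /eqP -> /andP[yok yn].
  rewrite /okw all_cat yok andbT wt_cat (eqP vt) yn size_cat size_takel ?vM
    ?leq_addr //.
  by move: vok; rewrite -{1}(cat_take_drop N v) all_cat => /andP[->].
have dE (v : seq L) : v \in V -> top v ->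
    der ((-1) ^+ b *: (mono (take N v) * (s v * lquo v z))) =
    mono v * lquo v z +
    (-1) ^+ b *: (der (mono (take N v)) * (s v * lquo v z)).
  move=> vV vt; rewrite linearZ /= derM [der (s v * _)]derM ds // dl // mulr0
    addr0.
  rewrite (@sgn_supp b); last by rewrite supp_mono.
  rewrite scalerDr -scalerAl scalerA -expr2 sqrr_sign scale1r addrC.
  by rewrite [in RHS](mono_N v) -mulrA.
rewrite (linear_sum der) big_seq_cond (eq_bigr (fun v => mono v * lquo v z +
    (-1) ^+ b *: (der (mono (take N v)) * (s v * lquo v z)))) => [|v /andP[]];
      last exact: dE.
rewrite -big_seq_cond big_split /= {1}zV (bigID top) /= opprD addrACA subrr
  add0r.
(* Two kinds of terms remain, both with a lighter initial segment: prefixes that are not [top], and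
   terms where the first [N] letters are differentiated. *)
have wN (v : seq L) f : v \in V -> wt (take N v) != b ->
    mono v * f \in supp (fun w => (wt (take N w) < b)%N).
  move=> vV vb; apply: suppM (supp_true f) => [x y xv _|].
    2: by apply: (@supp_mono _ _ _ (pred1 v)); rewrite /=.
  rewrite (eqP xv) take_N // ltn_neqAle vb.
  by have [_ _] := VP v vV; apply: leq_trans; apply: wt_take.
apply: rpredB; rewrite big_seq_cond; apply: rpred_sum => v /andP[vV vt];
  first exact: wN.
apply: rpredZ; have [vM _ _] := VP v vV.
have dN : der (mono (take N v)) \in
    supp (fun u => (N <= size u)%N && ((wt u).+1 == b)).
  rewrite der_mono -(eqP vt); apply: suppI; last exact: dword_wt.
  by apply: suppS (dword_size _) => u; rewrite size_takel // vM leq_addr.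
apply: suppM dN (supp_true _) => u x /andP[uN /eqP <-] _.
by rewrite takel_cat // ltnS wt_take.
Qed.

(** Each round lowers the bound on the prefix weight by one and costs [r] letters of length; the
    strict bound 0 leaves only [z = 0]. *)
Lemma prozero_aux b N n z : z \in supp (okw (N + r * b) n) ->
  z \in supp (fun w => (wt (take (N + r * b) w) < b)%N) -> der z = 0 ->
  exists2 s, s \in supp (okw N n.+1) & der s = z.
Proof.
elim: b z => [|b IH] z zok zb dz0.
  exists 0; first exact: rpred0.
  by rewrite linear0; apply: coefP => w; apply/esym/eqP; rewrite linear0;
    apply: contraT => /(suppP _ _ zb).
have NE : (N + r * b.+1 = N + r * b + r)%N by rewrite mulnS addnCA addnC.
rewrite NE in zok zb.
have [s sok zs] := prozero_step zok zb dz0.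
have dsok : z - der s \in supp (okw (N + r * b) n).
  apply: rpredB; first by apply: suppS zok => w; apply/okwS/leq_addr.
  by apply: suppS (der_okw sok) => w; rewrite eqSS.
have [|s' s'ok ds'] := IH _ dsok zs.
  by rewrite linearB /= dz0 der_der ?subrr.
exists (s' + s); last by rewrite linearD /= ds' subrK.
by apply: rpredD => //; apply: suppS sok => w; apply/okwS/leq_addr.
Qed.

(** Prefixes of a word of weight [n] weigh less than [n.+1], which is the number of rounds. *)
Lemma prozero n N z : z \in supp (okw (N + r * n.+1) n) -> der z = 0 ->
  exists2 s, s \in supp (okw N n.+1) & der s = z.
Proof.
move=> zok; apply: (prozero_aux zok).
by apply: suppS zok => w /and3P[_ /eqP <- _]; rewrite ltnS wt_take.
Qed.

End Derivation.

(** * Semi-free dgas *)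

Section SemiFree.
Variables (k : fieldType) (L : choiceType) (FA : free_algebra k L).
Variables (deg : L -> nat) (D : L -> FA) (ok : pred L).
Local Notation mono := (mono FA).
Local Notation wt := (wt deg).
Local Notation der := (der deg D).
Hypothesis D_wt : forall x, D x \in supp (fun w => (wt w).+1 == deg x).
Hypothesis D_size : forall x, D x \in supp (fun w => (0 < size w)%N).
Hypothesis D_ok : forall x, D x \in supp (all ok).
Hypothesis der_D : forall x, der (D x) = 0.

Section Component.
Variable i : int.

Definition deg_word (w : seq L) := all ok w && (- (wt w)%:Z == i).

Record sf_comp := SfComp { sf_val : FA; sf_valP : sf_val \in supp deg_word }.
HB.instance Definition _ := [isSub for sf_val].
HB.instance Definition _ := [Choice of sf_comp by <:].
HB.instance Definition _ := [SubChoice_isSubLmodule of sf_comp by <:].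

Lemma sf_val_okw (x : sf_comp) : sf_val x \in supp (okw deg ok 0 (absz i)).
Proof.
apply: suppS (sf_valP x) => w /andP[wok /eqP <-].
by rewrite /okw wok abszN absz_nat eqxx.
Qed.

Lemma sf_val_sgn (x : sf_comp) :
  sgn deg (sf_val x) = (-1) ^+ absz i *: sf_val x.
Proof. by apply: sgn_supp; apply: suppS (sf_val_okw x) => w /and3P[]. Qed.

Lemma sf_val_linear : linear sf_val. Proof. by []. Qed.
HB.instance Definition _ := GRing.isLinear.Build k sf_comp FA _ sf_val
  sf_val_linear.

End Component.

Lemma okw_deg_word i n w : i = - n%:Z -> okw deg ok 0 n w -> deg_word i w.
Proof. by move=> -> /and3P[wok /eqP <- _]; apply/andP. Qed.

Fact sf_mul_subproof i j n (e : i + j = n) (x : sf_comp i) (y : sf_comp j) :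
  sf_val x * sf_val y \in supp (deg_word n).
Proof.
apply: suppM (sf_valP x) (sf_valP y) =>
  u v /andP[uok /eqP ui] /andP[vok /eqP vj].
by rewrite /deg_word all_cat uok vok wt_cat -e -ui -vj PoszD opprD eqxx.
Qed.
Definition sf_mul i j n (e : i + j = n) (x : sf_comp i) (y : sf_comp j) :=
  SfComp (sf_mul_subproof e x y).

Fact sf_one_subproof : 1 \in @supp _ _ FA (deg_word 0).
Proof. by rewrite -(mono_nil FA); apply: supp_mono. Qed.
Definition sf_one := SfComp sf_one_subproof.

Fact sf_diff_subproof i j (e : i + 1 = j) (x : sf_comp i) :
  der (sf_val x) \in supp (deg_word j).
Proof.
have xd : der (sf_val x) \in supp (fun w =>
  [&& all ok w, (wt w).+1 == (absz i) & (0 <= size w)%N]).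
  exact: der_okw (sf_val_okw x).
have [i_gt0|i_le0] := ltP 0 i.
  suff -> : sf_val x = 0 by rewrite linear0 rpred0.
  apply: coefP => w; apply/eqP; rewrite linear0; apply: contraT.
  by move=> /(suppP _ _ (sf_valP x))/andP[_ /eqP wi]; lia.
apply: suppS xd => w /and3P[wok /eqP wi _].
rewrite /deg_word wok /=; lia.
Qed.
Definition sf_diff i j (e : i + 1 = j) (x : sf_comp i) :=
  SfComp (sf_diff_subproof e x).

Lemma sf_diff_linear i j (e : i + 1 = j) : linear (sf_diff e).
Proof. by move=> c x y; apply: val_inj; apply: linearP. Qed.

Program Definition sf_dga := @Dga k (fun i => sf_comp i : lmodType k)
  sf_mul sf_one (fun i j e => mk_linear (sf_diff_linear e))
  _ _ _ _ _ _ _.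
Next Obligation.
by move=> c x x'; apply: val_inj; rewrite /= mulrDl scalerAl.
Qed.
Next Obligation.
by move=> c x' x''; apply: val_inj; rewrite /= mulrDr scalerAr.
Qed.
Next Obligation. by apply: val_inj; apply: mulrA. Qed.
Next Obligation. by apply: val_inj; apply: mul1r. Qed.
Next Obligation. by apply: val_inj; apply: mulr1. Qed.
Next Obligation. by apply: val_inj; apply: der_der. Qed.
Next Obligation.
by apply: val_inj; rewrite /= derM sf_val_sgn -scalerAl.
Qed.

Definition sf_aug i (x : sf_comp i) : k := coef FA [::] (sf_val x).

Lemma sf_aug_linear i : scalar (@sf_aug i).
Proof. by move=> c x y; apply: linearP. Qed.

Program Definition sf_augDga := @AugDga k sf_dga
  (fun i => mk_scalar (@sf_aug_linear i)) _ _ _ _.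
Next Obligation.
apply/eqP; apply: contraT => /(suppP _ _ (sf_valP x))/andP[_ /eqP i0].
by move: H; rewrite -i0 oppr0 eqxx.
Qed.
Next Obligation. by rewrite /sf_aug /= -(mono_nil FA) coef_mono. Qed.
Next Obligation. exact: coef_nilM. Qed.
Next Obligation.
apply/eqP; apply: contraT.
have dx : der (sf_val x) \in supp (fun w => (0 < size w)%N).
  move: (sf_val x) (supp_true (sf_val x));
    apply: supp_ind => [|f g fn gn|c f fn|w _].
  - by rewrite linear0 rpred0.
  - by rewrite linearD rpredD.
  - by rewrite linearZ rpredZ.
  rewrite der_mono; case: w => [|y w]; first exact: rpred0.
  by apply: suppS (dword_size _ D_size (y :: w)) => u; apply: leq_trans.
by move=> /(suppP _ _ dx).
Qed.

Program Definition sf_npDga := @NpDga k sf_augDga _.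
Next Obligation.
apply: val_inj; apply: coefP => w; rewrite linear0.
by apply/eqP; apply: contraT => /(suppP _ _ (sf_valP x))/andP[_ /eqP wi]; lia.
Qed.

Lemma sf_augE i (x : sf_npDga i) : aug sf_npDga i x = coef FA [::] (sf_val x).
Proof. by []. Qed.

Definition long N i : {pred sf_npDga i} :=
  fun x => sf_val x \in supp (fun w => (N <= size w)%N).

Lemma long_submod N i : submod_closed (@long N i).
Proof.
by split=> [|c x y xN yN]; rewrite unfold_in;
  [apply: rpred0|rewrite linearP rpredD ?rpredZ].
Qed.
HB.instance Definition _ N i :=
  GRing.isSubmodClosed.Build k (sf_npDga i) (@long N i) (long_submod N i).
Definition sf_filt N i : submodClosed (sf_npDga i) := @long N i.

(** Letters of weight 0 can make the words of a given weight infinite in number; bounding the length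
    as well restores finiteness. *)
Hypothesis fin_words : forall n N, exists ws : seq (seq L), forall w,
  all ok w -> wt w = n -> (size w < N)%N -> w \in ws.

Definition sf_mono i w : sf_comp i := insubd 0 (mono w).

Lemma sf_monoE i w : deg_word i w -> sf_val (sf_mono i w) = mono w.
Proof. by move=> wi; rewrite [LHS]val_insubd supp_mono. Qed.

Lemma sf_filt_fin N i : exists (n : nat) (e : 'I_n -> sf_npDga i),
  forall x : sf_npDga i, exists c : 'I_n -> k,
    x - \sum_(l < n) c l *: e l \in sf_filt N i.
Proof.
have [ws wsP] := fin_words (absz i) N.
pose ws' := [seq w <- undup ws | deg_word i w].
exists (size ws'), (fun l => sf_mono i (nth [::] ws' l)) => x.
exists (fun l => coef FA (nth [::] ws' l) (sf_val x)).
apply/suppP => w.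
pose v : {linear sf_comp i -> FA} := @sf_val i.
rewrite -[sf_val (_ - _)]/(v _) linearB linear_sum /=.
rewrite (eq_bigr (fun l : 'I__ =>
  coef FA (nth [::] ws' l) (sf_val x) *: mono (nth [::] ws' l))) => [|l _];
    last first.
  rewrite sf_monoE //.
  by have := mem_nth [::] (ltn_ord l); rewrite mem_filter => /andP[].
rewrite -(big_mkord xpredT (fun l =>
  coef FA (nth [::] ws' l) (sf_val x) *: mono (nth [::] ws' l))).
rewrite -(big_nth [::] xpredT (fun u => coef FA u (sf_val x) *: mono u)) {v}.
rewrite linear_sum /=.
apply: contraR; rewrite -ltnNge => wN; apply/eqP.
have [wi|wi] := boolP (deg_word i w); last first.
  have /negPn/eqP -> : ~~ (coef FA w (sf_val x) != 0).
    by apply: contra wi; apply/(suppP _ _ (sf_valP x)).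
  rewrite sub0r big_seq big1 ?oppr0 // => v; rewrite mem_filter => /andP[vi _].
  rewrite linearZ /= coef_mono; case: eqP => [vw|]; last by rewrite mulr0.
  by rewrite -vw vi in wi.
have wws : w \in ws'.
  rewrite mem_filter wi mem_undup; case/andP: (wi) => wok /eqP wE.
  by apply: wsP => //; rewrite -wE abszN.
rewrite (bigD1_seq w) ?filter_uniq ?undup_uniq //= linearZ /= coef_mono eqxx
  mulr1.
rewrite big1 ?addr0 ?subrr // => v vw.
by rewrite linearZ /= coef_mono (negPf vw) mulr0.
Qed.

Variable r : nat.
Hypothesis word_bdry : forall w, all ok w -> wt w = 0 -> size w = r ->
  exists2 s, s \in supp (okw deg ok 0 1) & der s = mono w.

Lemma sf_prozero i : exists c : nat, forall N (x : sf_npDga i),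
  x \in sf_filt (N + c) i -> dd sf_npDga (erefl (i + 1)) x = 0 ->
  exists i' (e : i' + 1 = i) (y :
    sf_npDga i'), y \in sf_filt N i' /\ dd sf_npDga e y = x.
Proof.
exists (r * (absz i).+1)%N => N x xN dx.
have [i_gt0|i_le0] := ltP 0 i.
  exists (i - 1), (subrK 1 i), 0; split; first exact: rpred0.
  by rewrite linear0 (nonpos i_gt0 x).
have xok : sf_val x \in supp (okw deg ok (N + r * (absz i).+1) (absz i)).
  apply: suppS (suppI (sf_val_okw x) xN) => w /andP[/and3P[h1 h2 _] h3].
  exact/and3P.
have dx0 : der (sf_val x) = 0 by exact: (congr1 (@sf_val _) dx).
have [s sok ds] := prozero D_wt D_size D_ok der_D word_bdry xok dx0.
have sP : s \in supp (deg_word (i - 1)).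
  apply: suppS sok => w /and3P[h1 h2 _]; apply: (@okw_deg_word _ (absz i).+1);
    first lia.
  exact/and3P.
exists (i - 1), (subrK 1 i), (SfComp sP); split; last exact: val_inj.
by apply: suppS sok => w /and3P[].
Qed.

Lemma sf_limit : exists (P : proArtinian k) (M : npDga k)
    (p : forall a : pro_index P, dgaHom M (P a)),
    is_limit p /\ quasi_isomorphic sf_npDga M.
Proof.
apply: (@quasi_isomorphic_limit_of_filtration k sf_npDga sf_filt).
- by move=> i x; apply/suppP.
- by move=> n i x; apply: suppS => w; apply: ltnW.
- move=> i x x1; rewrite sf_augE; apply/eqP; apply: contraT.
  by move=> /(suppP _ _ x1).
- move=> N i j n e x y xN; apply: suppM xN (supp_true _) => u v uN _.
  by rewrite size_cat (leq_trans uN) // leq_addr.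
- move=> N i j n e x y yN; apply: suppM (supp_true _) yN => u v _ vN.
  by rewrite size_cat (leq_trans vN) // leq_addl.
- move=> N i j n e x y x0 yN.
  have x1 : sf_val x \in supp (fun w => (0 < size w)%N).
    apply/suppP => -[|//]; by rewrite -sf_augE x0 eqxx.
  by apply: suppM x1 yN => u v u1 vN; rewrite size_cat -add1n leq_add.
- by move=> N i j e x xN; apply: der_size.
- exact: sf_filt_fin.
- exact: sf_prozero.
Qed.

End SemiFree.

(** * Evaluation of noncommutative polynomials in a dga *)

Section Transport.
Variables (k : fieldType) (A : dga k).

(* Multiplication by the unit transports between equal degrees without casts;
   between distinct degrees the junk value is 0. *)
Definition transport i j (x : A i) : A j :=
  if pselect (i + 0 = j) is left e then dmul e x (dunit A) else 0.

Lemma transport_id i (x : A i) : transport i x = x.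
Proof.
rewrite /transport; case: pselect => [e|]; first exact: dmul1r.
by rewrite addr0.
Qed.

Lemma transport_linear i j : linear (@transport i j).
Proof.
move=> c x y; rewrite /transport; case: pselect => [e|_];
  first exact: dmul_linl.
by rewrite scaler0 addr0.
Qed.
HB.instance Definition _ i j := GRing.isLinear.Build k (A i) (A j) _
  (@transport i j) (@transport_linear i j).

End Transport.

Section Evaluation.
Variables (k : fieldType) (A : npDga k) (L : choiceType) (FA :
  free_algebra k L).
Variable deg : L -> nat.
Local Notation mono := (mono FA).
Local Notation wt := (wt deg).
Variable v : forall x : L, A (- (deg x)%:Z).

Definition wdeg (w : seq L) : int := - (wt w)%:Z.

Fact wdeg_cons x w : - (deg x)%:Z + wdeg w = wdeg (x :: w).
Proof. by rewrite /wdeg wt_cons PoszD opprD. Qed.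

Fixpoint wval (w : seq L) : A (wdeg w) :=
  if w is x :: u then dmul (wdeg_cons x u) (v x) (wval u) else dunit A.

(** Defined on the whole algebra for each target degree: [transport] sends words of any other degree
    to 0. *)
Definition ev i : FA -> A i := lext (fun w => transport i (wval w)).
HB.instance Definition _ i :=
  GRing.Linear.copy (@ev i) (lext (fun w => transport i (wval w))).

Lemma ev_mono i w : ev i (mono w) = transport i (wval w).
Proof. exact: lext_mono. Qed.

Lemma wval_cat u w n (e : wdeg u + wdeg w = n) :
  transport n (wval (u ++ w)) = dmul e (wval u) (wval w).
Proof.
elim: u n e => [|x u IH] n e.
  have en : n = wdeg w by rewrite -e add0r.
  move: e; rewrite en => e; rewrite [LHS]transport_id; exact/esym/dmul1l.
have en : n = wdeg (x :: (u ++ w)).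
  by rewrite -e /wdeg /= !wt_cons wt_cat; lia.
move: e; rewrite en => e; rewrite [LHS]transport_id /=.
have e' : wdeg u + wdeg w = wdeg (u ++ w) by rewrite /wdeg wt_cat; lia.
rewrite -[wval (u ++ w)]transport_id (IH _ e'); exact: dmulA.
Qed.

Lemma evM i j n (e : i + j = n) f g :
  f \in supp (fun w => wdeg w == i) -> g \in supp (fun w => wdeg w == j) ->
  ev n (f * g) = dmul e (ev i f) (ev j g).
Proof.
move=> fi gj; move: f fi; apply: supp_ind => [|f1 f2 h1 h2|c f h|u /eqP ui].
- by rewrite mul0r 2!linear0 dmul0l.
- by rewrite mulrDl 2!linearD /= h1 h2 dmulDl.
- by rewrite -scalerAl 2!linearZ /= h dmulZl.
move: g gj; apply: supp_ind => [|f1 f2 h1 h2|c f h|w /eqP wj].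
- by rewrite mulr0 2!linear0 dmul0r.
- by rewrite mulrDr 2!linearD /= h1 h2 dmulDr.
- by rewrite -scalerAr 2!linearZ /= h dmulZr.
by subst i j; rewrite -mono_cat !ev_mono !transport_id wval_cat.
Qed.

Lemma ev_letter x : ev (- (deg x)%:Z) (mono [:: x]) = v x.
Proof.
have e : wdeg [:: x] = - (deg x)%:Z by rewrite /wdeg wt_cons addn0.
have ex : - (deg x)%:Z + 0 = wdeg [:: x] by rewrite e addr0.
rewrite ev_mono /= (dmul_irr _ ex) /=.
by move: ex; rewrite e => ex; rewrite transport_id dmul1r.
Qed.

Variable D : L -> FA.
Local Notation der := (der deg D).
Hypothesis D_wt : forall x, D x \in supp (fun w => (wt w).+1 == deg x).
Hypothesis D_ev : forall x, ev (- (deg x)%:Z + 1) (D x) = dd A (erefl _) (v x).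

(** Both sides obey the Leibniz rule along evaluation, so the agreement [D_ev] on letters propagates
    to words. *)
Lemma ev_der i j (e : i + 1 = j) f : f \in supp (fun w => wdeg w == i) ->
  ev j (der f) = dd A e (ev i f).
Proof.
move: f; apply: supp_ind => [|f1 f2 h1 h2|c f h|w /eqP wi].
- by rewrite !linear0.
- by rewrite 4!linearD /= h1 h2.
- by rewrite 4!linearZ /= h.
subst i; rewrite der_mono ev_mono transport_id.
elim: w j e => [|x w IH] j e; first by rewrite linear0 dd1.
have DE : D x \in supp (fun w => wdeg w == - (deg x)%:Z + 1).
  by apply: suppS (D_wt x) => u /eqP <-; rewrite /wdeg; apply/eqP; lia.
have dE : dword deg D w \in supp (fun u => wdeg u == wdeg w + 1).
  by apply: suppS (dword_wt D_wt w) => u /eqP; rewrite /wdeg => <-; apply/eqP;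
    lia.
have e1 : (- (deg x)%:Z + 1) + wdeg w = j by rewrite -e -wdeg_cons addrAC.
have e2 : - (deg x)%:Z + (wdeg w + 1) = j by rewrite -e -wdeg_cons addrA.
rewrite /= linearD linearZ /= (evM e1 DE); last by rewrite supp_mono.
rewrite (evM e2 _ dE); last by rewrite supp_mono // /wdeg wt_cons addn0.
rewrite (dleibniz _ _ (erefl _) e1 (erefl _) e2) D_ev ev_mono transport_id
  ev_letter.
by rewrite abszN (IH _ (erefl _)).
Qed.

Hypothesis v_aug : forall x, aug A _ (v x) = 0.

Lemma ev_aug i f : f \in supp (fun w => wdeg w == i) ->
  aug A i (ev i f) = coef FA [::] f.
Proof.
move: f; apply: supp_ind => [|f1 f2 h1 h2|c f h|w /eqP wi].
- by rewrite !linear0.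
- by rewrite 3!linearD /= h1 h2.
- by rewrite 3!linearZ /= h.
subst i; rewrite ev_mono transport_id coef_mono.
by case: w => [|x w] /=; [rewrite aug1|rewrite augM v_aug mul0r].
Qed.

End Evaluation.

Section Agreement.
Variables (k : fieldType) (A : npDga k) (L : choiceType) (FA :
  free_algebra k L).
Variables (deg : L -> nat) (ok : pred L).
Variables (D D' : L -> FA) (v v' : forall x : L, A (- (deg x)%:Z)).
Hypothesis DD' : forall x, ok x -> D x = D' x.
Hypothesis vv' : forall x, ok x -> v x = v' x.

Lemma der_agree f : f \in supp (all ok) -> der deg D f = der deg D' f.
Proof.
move: f; apply: supp_ind => [|f1 f2 h1 h2|c f h|w].
- by rewrite !linear0.
- by rewrite 2!linearD /= h1 h2.
- by rewrite 2!linearZ /= h.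
rewrite !der_mono; elim: w => //= x w IH /andP[xok wok].
by rewrite DD' // IH.
Qed.

Lemma ev_agree i (f : FA) : f \in supp (all ok) -> ev v i f = ev v' i f.
Proof.
move: f; apply: supp_ind => [|f1 f2 h1 h2|c f h|w wok].
- by rewrite !linear0.
- by rewrite 2!linearD /= h1 h2.
- by rewrite 2!linearZ /= h.
rewrite !ev_mono; congr transport.
elim: w wok => //= x w IH /andP[xok wok].
by rewrite vv' // IH.
Qed.

End Agreement.

(** Finitely many linear forms cut out a subspace of finite codimension in [K], even if [K] is
    infinite-dimensional, and [zs] generates the quotient. Each form that is nonzero on [K]
    contributes one vector; the induction continues on its kernel in [K]. *)
Lemma subspace_generators (k : fieldType) (V : lmodType k) (K : submodClosed V)
    (I : Type) (phi : I -> {scalar V}) (s : seq I) :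
  exists zs : seq V, {subset zs <= K} /\ forall x, x \in K -> exists c : nat ->
    k,
    List.Forall (fun i => phi i (x - \sum_(l < size zs) c l *: zs`_l) = 0) s.
Proof.
elim: s K => [|i s IH] K.
  exists [::]; split=> // x _; exists (fun _ => 0); exact: List.Forall_nil.
pose K' : {pred V} := fun x => (x \in K) && (phi i x == 0).
have K'sub : submod_closed K'.
  split=> [|c x y /andP[xK /eqP x0] /andP[yK /eqP y0]]; apply/andP; split.
  - exact: rpred0.
  - by rewrite linear0.
  - by apply: rpredD => //; apply: rpredZ.
  - by rewrite linearP /= x0 y0 mulr0 addr0.
pose SK' : submodClosed V :=
  HB.pack K' (GRing.isSubmodClosed.Build k V K' K'sub).
have [zs [zsK zsP]] := IH SK'.
have zsK1 : {subset zs <= K} by move=> x /zsK /andP[].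
have zs0 : forall x, x \in zs -> phi i x = 0 by move=> x /zsK /andP[_ /eqP].
have [[z0 [z0K z0i]]|noz] := pselect (exists z0, z0 \in K /\ phi i z0 != 0).
  exists (z0 :: zs); split=> [x|x xK].
    by rewrite inE => /orP[/eqP ->//|]; apply: zsK1.
  (* This multiple of [z0] moves [x] into the kernel of [phi i]. *)
  pose a := phi i x / phi i z0.
  have x'K : x - a *: z0 \in SK'.
    apply/andP; split; first by apply: submodB => //; apply: rpredZ.
    by rewrite linearB linearZ /= divfK // subrr.
  have [c cP] := zsP _ x'K.
  exists (fun l => if l is l'.+1 then c l' else a).
  rewrite big_ord_recl /= opprD addrA; constructor => //.
  rewrite linearB linear_sum /= big1 ?subr0 => [|l _].
    by case/andP: x'K => _ /eqP.
  by rewrite linearZ /= [phi i _](zs0 _ (mem_nth 0 (ltn_ord l))) mulr0.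
exists zs; split=> // x xK.
have x0 : phi i x = 0.
  by apply/eqP; apply: contraT => xi; case: noz; exists x.
have xK' : x \in SK' by apply/andP; rewrite x0 eqxx.
have [c cP] := zsP x xK'.
exists c; constructor => //.
rewrite linearB linear_sum /= big1 ?subr0 // => l _.
by rewrite linearZ /= (zs0 _ (mem_nth 0 (ltn_ord l))) mulr0.
Qed.

(** * Finite presentations *)

Section Presentations.
Variables (k : fieldType) (A : npDga k) (FA : free_algebra k (nat * nat)%type).
Local Notation mono := (mono FA).
Local Notation wt := (wt fst).

(* The letter [(m, l)] is the [l]-th generator of degree [- m]; only the letters
   with [l < pcard m] are used. *)
Record presentation := Presentation {
  pcard : nat -> nat;
  pdiff : nat * nat -> FA;
  pval : forall x : nat * nat, A (- (x.1)%:Z)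
}.

Definition letter p : pred (nat * nat) := fun x => (x.2 < pcard p x.1)%N.
Definition pder p : FA -> FA := der fst (pdiff p).
HB.instance Definition _ p := GRing.Linear.copy (pder p) (der fst (pdiff p)).
Definition pev p i : FA -> A i := @ev k A _ FA fst (pval p) i.
HB.instance Definition _ p i :=
  GRing.Linear.copy (@pev p i) (@ev k A _ FA fst (pval p) i).
Definition pword p := okw fst (letter p).

Record valid p : Prop := Valid {
  v_wt : forall x, pdiff p x \in supp (fun w => (wt w).+1 == x.1);
  v_size : forall x, pdiff p x \in supp (fun w => (0 < size w)%N);
  v_ok : forall x, pdiff p x \in supp (all (letter p));
  v_der : forall x, pder p (pdiff p x) = 0;
  v_ev : forall x, pev p (- (x.1)%:Z + 1) (pdiff p x) =
    dd A (erefl _) (pval p x);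
  v_aug : forall x, aug A _ (pval p x) = 0
}.

(** Words of weight at most [n] are the same for both presentations, so what was achieved in low
    weight is inherited by later stages. *)
Definition agree n p p' :=
  (forall x, letter p x ->
    [/\ letter p' x, pdiff p x = pdiff p' x & pval p x = pval p' x]) /\
  (forall x, (x.1 <= n)%N -> letter p' x -> letter p x).

Lemma agree_refl n p : agree n p p. Proof. by []. Qed.

Lemma agree_trans m n p q r : (m <= n)%N -> agree m p q -> agree n q r ->
  agree m p r.
Proof.
move=> mn [pq qp] [qr rq]; split=> [x /pq[qx -> ->]|x xm rx]; first exact: qr.
by apply: qp => //; apply: rq => //; apply: leq_trans xm mn.
Qed.

Section Agree.
Variables (n : nat) (p p' : presentation).
Hypothesis pp' : agree n p p'.

Lemma agree_pder f : f \in supp (all (letter p)) -> pder p f = pder p' f.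
Proof. by apply: der_agree => x /pp'.1[]. Qed.

Lemma agree_pev i f : f \in supp (all (letter p)) -> pev p i f = pev p' i f.
Proof. by apply: ev_agree => x /pp'.1[]. Qed.

Lemma agree_ok (f : FA) : f \in supp (all (letter p)) ->
  f \in supp (all (letter p')).
Proof.
by apply: suppS => w; apply: sub_all => x /pp'.1[].
Qed.

Lemma agree_pword N m w : pword p N m w -> pword p' N m w.
Proof.
move=> /and3P[wok wm wN]; apply/and3P; split=> //.
by apply: sub_all wok => x /pp'.1[].
Qed.

Lemma agree_pword_inv N m w : (m <= n)%N -> pword p' N m w -> pword p N m w.
Proof.
move=> mn /and3P[wok /eqP wm wN]; apply/and3P; split; rewrite ?wm //.
have {wm}mn : (wt w <= n)%N by rewrite wm.
elim: w wok mn {wN} => //= x w IH /andP[xok wok].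
rewrite wt_cons => xwn; rewrite IH ?pp'.2 //.
  by apply: leq_trans xwn; rewrite leq_addr.
by apply: leq_trans xwn; rewrite leq_addl.
Qed.

End Agree.

Lemma pword_ok p N m (f : FA) : f \in supp (pword p N m) ->
  f \in supp (all (letter p)).
Proof. by apply: suppS => w /and3P[]. Qed.

Lemma pword_wt p N m (f : FA) : f \in supp (pword p N m) ->
  f \in supp (fun w => wt w == m).
Proof. by apply: suppS => w /and3P[]. Qed.

Lemma pword_deg p N m (f : FA) : f \in supp (pword p N m) ->
  f \in supp (fun w => wdeg fst w == - m%:Z).
Proof. by apply: suppS => w /and3P[_ /eqP <- _]. Qed.

(** Together with [pinj], this expresses on elements of the free algebra that evaluation is onto,
    respectively one-to-one, on H^(-m). *)
Definition psurj p m := forall a : A (- m%:Z), dd A (erefl _) a = 0 ->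
  exists2 t, t \in supp (pword p 0 m) & pder p t = 0 /\ bdry (pev p _ t - a).

Definition pinj p m := forall t, t \in supp (pword p 0 m) -> pder p t = 0 ->
  bdry (pev p (- m%:Z) t) ->
  exists2 s, s \in supp (pword p 0 m.+1) & pder p s = t.

Lemma agree_psurj n p p' m : agree n p p' -> psurj p m -> psurj p' m.
Proof.
move=> pp' ps a /ps[t tp [dt et]]; exists t.
  by apply: suppS tp; apply: agree_pword pp' _ _.
have tok := pword_ok tp.
by rewrite -(agree_pder pp') // -(agree_pev pp').
Qed.

(** The elements to be bounded involve no new letter, and the elements that bound them persist. *)
Lemma agree_pinj n p p' m : agree n p p' -> (m < n)%N -> pinj p m -> pinj p' m.
Proof.
move=> pp' mn pin t tp' dt et.
have tp : t \in supp (pword p 0 m).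
  by apply: suppS tp' => w; apply: (agree_pword_inv pp' (ltnW mn)).
have tok := pword_ok tp.
have [||s sp ds] := pin t tp; rewrite ?(agree_pder pp') ?(agree_pev pp') //.
exists s; first by apply: suppS sp; apply: agree_pword pp' _ _.
by rewrite -(agree_pder pp') //; apply: pword_ok sp.
Qed.

Lemma pev_pder p N m f : valid p -> f \in supp (pword p N m.+1) ->
  bdry (pev p (- m%:Z) (pder p f)).
Proof.
move=> pv fp; have e : - m.+1%:Z + 1 = - m%:Z by lia.
exists (- m.+1%:Z), e, (pev p _ f).
by rewrite -(ev_der (v_wt pv) (v_ev pv) e) // (pword_deg fp).
Qed.

Section Extension.
Variables (n : nat) (p : presentation) (g : nat).
Variables (Gz : nat -> FA) (Ga : nat -> A (- (n.+1)%:Z)).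
Hypothesis pv : valid p.
Hypothesis p_bound : forall x, letter p x -> (x.1 <= n)%N.
Hypothesis Gz_word : forall l, Gz l \in supp (pword p 1 n).
Hypothesis Gz_der : forall l, pder p (Gz l) = 0.
Hypothesis Gz_ev : forall l,
  pev p (- (n.+1)%:Z + 1) (Gz l) = dd A (erefl _) (Ga l).

(** Letters of weight [n.+1] with index at least [g] also get values, which is why [Gz] and [Ga]
    satisfy their hypotheses at every index. *)
Definition extend := Presentation
  (fun m => if m == n.+1 then g else pcard p m)
  (fun x => if x.1 == n.+1 then Gz x.2 else pdiff p x)
  (fun x => if x.1 == n.+1 then transport _ (Ga x.2) else pval p x).

Lemma extend_neq x : letter p x -> (x.1 == n.+1) = false.
Proof. by move=> /p_bound xn; apply/negP => /eqP xE; rewrite xE ltnn in xn. Qed.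

Lemma extend_agree : agree n p extend.
Proof.
split=> [x xp|x xn]; first by rewrite /letter /= !(extend_neq xp).
by rewrite /letter /=; case: eqP => // xE; rewrite xE ltnn in xn.
Qed.

Lemma extend_bound x : letter extend x -> (x.1 <= n.+1)%N.
Proof.
rewrite /letter /=; case: eqP => [->//|_] xp.
by apply: leq_trans (leqnSn n); apply: p_bound.
Qed.

Lemma extend_valid : valid extend.
Proof.
have Gz_ok l := pword_ok (Gz_word l).
split=> -[m l] /=.
- case: eqP => [->|_]; last exact: v_wt.
  by apply: suppS (Gz_word l) => w /and3P[_ /eqP -> _].
- case: eqP => _; last exact: v_size.
  by apply: suppS (Gz_word l) => w /and3P[].
- by apply: (agree_ok extend_agree); case: eqP => // _; apply: v_ok.
- case: eqP => _; rewrite -(agree_pder extend_agree) // ?v_der //.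
  exact: v_ok.
- case: eqP => [mE|_]; rewrite -(agree_pev extend_agree) //.
  + by subst m; rewrite transport_id Gz_ev.
  + exact: (v_ev pv (m, l)).
  + exact: v_ok.
- case: eqP => [mE|_]; last exact: (v_aug pv (m, l)).
  by subst m; rewrite transport_id aug_deg.
Qed.

End Extension.

Lemma cohomology_generators j : fin_dim (coh A j) ->
  exists (q : nat) (e : nat ->
    A j), (forall l, dd A (erefl (j + 1)) (e l) = 0) /\
    forall a, dd A (erefl (j + 1)) a = 0 ->
      exists c : nat -> k, bdry (a - \sum_(l < q) c l *: e l).
Proof.
move=> [q [E EP]].
exists q, (fun l => if insub l is Some l' then cval (repr (E l')) else 0).
split=> [l|a ac].
  by case: insub => [l'|]; rewrite ?linear0 // dcval.
have [c cE] := EP (\pi_(coh A j) (Cocycle (mk_cocycleP ac))).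
exists (fun l => if insub l is Some l' then c l' else 0).
have aE : \pi_(coh A j) (Cocycle (mk_cocycleP ac)) =
    \pi_(coh A j) (\sum_(l < q) c l *: repr (E l)).
  rewrite cE [RHS]linear_sum; apply: eq_bigr => l _.
  by rewrite linearZ /= reprK.
have /coh_eqP := aE; congr bdry; congr (_ - _).
have cval_linear : linear (@cval k A j) by [].
rewrite [LHS](linear_sum (mk_linear cval_linear)); apply: eq_bigr => l _.
by rewrite valK.
Qed.

End Presentations.

(** * Killing cohomology degree by degree *)

Section Stages.
Variables (k : fieldType) (A : npDga k) (FA : free_algebra k (nat * nat)%type).
Hypothesis fdA : coh_loc_finite A.
Local Notation mono := (mono FA).
Local Notation wt := (wt fst).
Local Notation presentation := (presentation A FA).
Implicit Types p : presentation.

(** Injectivity lags one weight behind surjectivity: it is obtained in weight [n] by adding letters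
    of weight [n.+1]. *)
Definition stage n p := [/\ valid p, forall x, letter p x -> (x.1 <= n)%N,
  forall m, (m <= n)%N -> psurj p m & forall m, (m < n)%N -> pinj p m].

Lemma finite_words p n N : exists ws : seq (seq (nat * nat)), forall w,
  all (letter p) w -> (wt w <= n)%N -> (size w < N)%N -> w \in ws.
Proof.
pose ls := [seq (m, l) | m <- iota 0 n.+1, l <- iota 0 (pcard p m)].
elim: N => [|N [ws wsP]]; first by exists [::].
exists ([::] :: [seq x :: w | x <- ls, w <- ws]) => -[|[m l] w] //=.
rewrite wt_cons /= => /andP[xok wok] mwn wN; rewrite inE /=.
apply: allpairs_f; last by apply: wsP => //; apply: leq_trans mwn;
  apply: leq_addl.
apply: allpairs_f_dep; rewrite mem_iota //= ltnS.
by apply: leq_trans mwn; apply: leq_addr.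
Qed.

Lemma pder_weight0 p (f : FA) : valid p -> f \in supp (pword p 0 0) ->
  pder p f = 0.
Proof.
move=> pv fp; have d0 := der_wt (v_wt pv) (pword_wt fp).
by apply: coefP => w; rewrite linear0; apply/eqP;
  apply: contraT => /(suppP _ _ d0).
Qed.

Definition kernel p n : {pred FA} := fun z =>
  `[< [/\ z \in supp (pword p 0 n), pder p z = 0 & bdry (pev p (- n%:Z) z)] >].

Lemma kernel_submod p n : submod_closed (kernel p n).
Proof.
split=> [|c x y /asboolP[xp dx ex] /asboolP[yp dy ey]]; apply/asboolP.
  by split; rewrite ?linear0 ?rpred0 //; apply: bdry0.
split; first by rewrite rpredD ?rpredZ.
  by rewrite linearP /= dx dy scaler0 addr0.
by rewrite linearP /=; apply: bdryD => //; apply: bdryZ.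
Qed.
HB.instance Definition _ p n :=
  GRing.isSubmodClosed.Build k FA (kernel p n) (kernel_submod p n).

Lemma kernelP p n z : z \in kernel p n <->
  [/\ z \in supp (pword p 0 n), pder p z = 0 & bdry (pev p (- n%:Z) z)].
Proof. by split=> /asboolP. Qed.

(** The augmentation kills boundaries, so there is no constant term; hence [z] may serve as the
    differential of a new letter. *)
Lemma kernel_size p n z : valid p -> z \in kernel p n ->
  z \in supp (pword p 1 n).
Proof.
move=> pv /kernelP[zp _ ez]; have z0 : coef FA [::] z = 0.
  by rewrite -(ev_aug (v_aug pv) (pword_deg zp)) aug_bdry.
apply/suppP => w w0; have /and3P[h1 h2 _] := suppP _ _ zp w w0.
apply/and3P; split=> //; case: w w0 {h1 h2} => //; by rewrite z0 eqxx.
Qed.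

(** Of the new letters of weight [n.+1], the first [q] are cocycles sent to generators of the
    cohomology of A, and the others have the elements of [zs] as differentials. *)
Lemma kill n p (zs : seq FA) : stage n p -> {subset zs <= kernel p n} ->
  exists p', [/\ valid p', forall x, letter p' x ->
    (x.1 <= n.+1)%N, agree n p p',
    psurj p' n.+1 &
    {in zs, forall z, exists2 s, s \in supp (pword p' 0 n.+1) & pder p' s = z}].
Proof.
move=> [pv pb ps pi] zsK.
have [q [e [ec eP]]] := cohomology_generators (fdA (- (n.+1)%:Z)).
(* Beyond the end of [zs] the default 0 is also in the kernel, so letters of every index are
   covered. *)
have zK l : zs`_l \in kernel p n.
  have [lz|lz] := ltnP l (size zs); first exact/zsK/mem_nth.
  by rewrite nth_default // rpred0.
have aP l : exists a : A (- (n.+1)%:Z),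
    dd A (erefl _) a = pev p (- (n.+1)%:Z + 1) zs`_l.
  have /kernelP[_ _] := zK l.
  have -> : - n%:Z = - (n.+1)%:Z + 1 by lia.
  move=> [i [e' [b bE]]]; have ei : i = - (n.+1)%:Z by lia.
  by subst i; exists b; rewrite -bE; apply: dd_irr.
pose a l := projT1 (cid (aP l)).
have aE l : dd A (erefl _) (a l) = pev p (- (n.+1)%:Z + 1) zs`_l.
  by rewrite /a; case: cid.
pose Gz l := if (l < q)%N then 0 else zs`_(l - q).
pose Ga l := if (l < q)%N then e l else a (l - q)%N.
pose p' := extend p (q + size zs) Gz Ga.
have Gz_word l : Gz l \in supp (pword p 1 n).
  by rewrite /Gz; case: ifP => _; [apply: rpred0|apply: kernel_size].
have Gz_der l : pder p (Gz l) = 0.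
  rewrite /Gz; case: ifP => _; first exact: linear0.
  by have /kernelP[] := zK (l - q)%N.
have Gz_ev l : pev p (- (n.+1)%:Z + 1) (Gz l) = dd A (erefl _) (Ga l).
  by rewrite /Gz /Ga; case: ifP => _; rewrite ?aE // linear0 ec.
have letE l : letter p' (n.+1, l) = (l < q + size zs)%N.
  by rewrite /letter /= eqxx.
have diffE l : pder p' (mono [:: (n.+1, l)]) = Gz l.
  by rewrite [LHS]der_letter /= eqxx.
have valE l : pev p' (- (n.+1)%:Z) (mono [:: (n.+1, l)]) = Ga l.
  by rewrite [LHS](ev_letter _ (pval p') (n.+1, l)) /= eqxx transport_id.
have letS l : (l < q + size zs)%N ->
    mono [:: (n.+1, l)] \in supp (pword p' 0 n.+1).
  by move=> lq; apply: supp_mono;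
    rewrite /pword /okw /= letE lq wt_cons addn0 eqxx.
exists p'; split.
- exact: extend_valid.
- exact: extend_bound.
- exact: extend_agree.
- move=> b /eP[c bE]; exists (\sum_(l < q) c l *: mono [:: (n.+1, val l)]).
    by apply: rpred_sum => l _; apply: rpredZ; apply: letS;
      apply: ltn_addr (ltn_ord l).
  split.
    rewrite (linear_sum (pder p')) big1 // => l _.
    by rewrite linearZ /= diffE /Gz ltn_ord scaler0.
  rewrite (linear_sum (pev p' _)) -opprB; apply: bdryN.
  move: bE; congr (bdry (_ - _)); apply: eq_bigr => l _.
  by rewrite linearZ /= valE /Ga ltn_ord.
- move=> z zzs; exists (mono [:: (n.+1, q + index z zs)%N]).
    by apply: letS; rewrite ltn_add2l index_mem.
  by rewrite diffE /Gz ltnNge leq_addr /= addKn nth_index.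
Qed.

Lemma pev_word0 p w : valid p -> wt w = 0 -> exists s : nat -> A 0,
  (forall i, aug A 0 (s i) = 0) /\ pev p 0 (mono w) = iprod s (size w).
Proof.
move=> pv; elim: w => [|x w IH] w0.
  exists (fun _ => 0); split=> [i|]; first exact: linear0.
  by rewrite [LHS]ev_mono; apply: transport_id.
move: w0; rewrite wt_cons => /eqP; rewrite addn_eq0 => /andP[/eqP x0 /eqP w0].
have [s [s0 sE]] := IH w0.
have xd : mono [:: x] \in supp (fun w => wdeg fst w == 0).
  by apply: supp_mono; rewrite /wdeg wt_cons x0.
(* The first letter of the word is the leftmost factor, so it takes the last index of [iprod]. *)
exists (fun i => if i == size w then pev p 0 (mono [:: x]) else s i); split.
  move=> i; case: ifP => // _.
  by rewrite [LHS](ev_aug (v_aug pv) xd) coef_mono.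
rewrite -cat1s mono_cat [LHS](evM _ (addr0 0)) //; last first.
  by apply: supp_mono; rewrite /wdeg w0.
rewrite /= eqxx; congr dmul; rewrite [LHS]sE.
suff ext m : (m <= size w)%N -> iprod s m = iprod
    (fun i => if i == size w then pev p 0 (mono [:: x]) else s i) m by apply:
      ext.
elim: m => //= i IHi iw.
by rewrite IHi ?(ltnW iw) // (ltn_eqF iw).
Qed.

Hypothesis nilA : exists n, forall s : nat -> A 0,
  (forall i, aug A 0 (s i) = 0) -> bdry (iprod s n).

(** Nilpotence holds in A; injectivity on H^0 transfers it to words of the free algebra, which in
    weight 0 are cocycles. *)
Lemma words_bdry p : valid p -> pinj p 0 -> exists r, forall w,
  all (letter p) w -> wt w = 0 -> size w = r ->
  exists2 s, s \in supp (pword p 0 1) & pder p s = mono w.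
Proof.
move=> pv pi0; have [r rP] := nilA; exists r => w wok w0 wr.
have wp : mono w \in supp (pword p 0 0) by rewrite supp_mono // /pword /okw wok
  w0 eqxx.
apply: pi0 => //; first exact: pder_weight0.
have [s [s0 sE]] := pev_word0 pv w0.
by rewrite [pev _ _ _]sE wr; apply: rP.
Qed.

(** The kernel may be infinite-dimensional, but its elements supported on words of length at least
    [M] are already boundaries for [p]. Only the coefficients at the finitely many shorter words
    matter, and [subspace_generators] applies to these. *)
Lemma next_stage n p : stage n.+1 p ->
  exists2 p', stage n.+2 p' & agree n.+1 p p'.
Proof.
move=> pst; have [pv pb ps pi] := pst.
have [r rP] := words_bdry pv (pi 0%N isT).
have pz := prozero (v_wt pv) (v_size pv) (v_ok pv) (v_der pv) rP.
(* The constant of [prozero] in weight [n.+1], used with [N = 0]. *)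
pose M := (r * n.+2)%N.
have [ws wsP] := finite_words p n.+1 M.
have [zs [zsK zsP]] := subspace_generators (kernel p n.+1) (fun w =>
  coef FA w) ws.
have [p' [pv' pb' pp' ps' kz]] := kill pst zsK.
exists p' => //; split=> // m.
  rewrite leq_eqVlt => /orP[/eqP -> //|mn].
  by apply: agree_psurj pp' _; apply: ps.
rewrite ltnS leq_eqVlt => /orP[/eqP ->|mn]; last first.
  by apply: agree_pinj pp' _ _ => //; apply: pi.
move=> t tp' dt et.
have tp : t \in supp (pword p 0 n.+1).
  by apply: suppS tp' => w; apply: (agree_pword_inv pp').
have tok := pword_ok tp.
have tK : t \in kernel p n.+1.
  by apply/kernelP; rewrite (agree_pder pp') // (agree_pev pp').
have [c cP] := zsP t tK.
set u := t - _ in cP.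
have uK : u \in kernel p n.+1.
  rewrite rpredB // rpred_sum // => l _; rewrite rpredZ //; exact/zsK/mem_nth.
have /kernelP[up du _] := uK.
have uM : u \in supp (pword p (0 + M) n.+1).
  apply/suppP => w uw; have /and3P[h1 h2 _] := suppP _ _ up w uw.
  apply/and3P; split=> //; rewrite leqNgt; apply/negP => wM.
  have wws : w \in ws by apply: wsP => //; rewrite (eqP h2).
  move: uw; have -> : coef FA w u = 0; last by rewrite eqxx.
  elim: cP wws => //= w' s w'0 _ IH; rewrite inE => /orP[/eqP ->|] //.
have [s sp ds] := pz _ _ _ uM du.
have sP l : exists s', (l < size zs)%N ->
    s' \in supp (pword p' 0 n.+2) /\ pder p' s' = zs`_l.
  have [lz|lz] := ltnP l (size zs); last by exists 0.
  by have [s' s'p ds'] := kz _ (mem_nth 0 lz); exists s'.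
pose sz l := projT1 (cid (sP l)).
have szP l : (l < size zs)%N ->
    sz l \in supp (pword p' 0 n.+2) /\ pder p' (sz l) = zs`_l.
  by rewrite /sz; case: cid.
exists (s + \sum_(l < size zs) c l *: sz l).
  rewrite rpredD //; first by apply: suppS sp; apply: agree_pword pp' _ _.
  by rewrite rpred_sum // => l _; rewrite rpredZ //; case: (szP l).
have sok := pword_ok sp.
rewrite linearD (linear_sum (pder p')) /= -(agree_pder pp') // [pder p s]ds.
rewrite (eq_bigr (fun l : 'I__ => c l *: zs`_l)) ?subrK // => l _.
by rewrite linearZ /=; case: (szP l) => // _ ->.
Qed.

End Stages.

(** * Locally finite semi-free resolutions *)

Section Resolution.
Variables (k : fieldType) (A : npDga k) (FA : free_algebra k (nat * nat)%type).
Hypothesis fdA : coh_loc_finite A.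
Local Notation mono := (mono FA).
Local Notation wt := (wt fst).
Local Notation presentation := (presentation A FA).
Implicit Types p : presentation.

(* Surjectivity in degree 0 is already achieved by words of length at most 1:
   the letters are sent to a spanning set of the augmentation ideal of the
   cohomology. *)
Lemma stage0_exists : exists2 p : presentation, stage 0 p &
  forall a : A 0, exists2 t, t \in supp (pword p 0 0) &
    t \in supp (fun w => (size w <= 1)%N) /\ bdry (pev p 0 t - a).
Proof.
have [q [e [ec eP]]] := cohomology_generators (fdA 0).
(* Letters must take values in the augmentation ideal; the multiples of the unit subtracted here are
   put back by [c0]. *)
pose a l := e l - aug A 0 (e l) *: dunit A.
have a0 l : aug A 0 (a l) = 0 by rewrite linearB linearZ /= aug1 mulr1 subrr.
pose p : presentation := Presentation (fun m => if m == 0%N then q else 0%N)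
  (fun _ => 0) (fun x => if x.1 == 0%N then transport _ (a x.2) else 0).
have letE m l : letter p (m, l) = (m == 0%N) && (l < q)%N.
  by rewrite /letter /=; case: eqP => // _; rewrite ltn0.
have pv : valid p.
  split=> [x|x|x|x|[m l]|[m l]] /=; rewrite ?rpred0 ?linear0 //.
    case: eqP => [m0|_]; last by rewrite linear0.
    by apply/esym/nonpos; rewrite m0.
  case: eqP => [m0|_]; last exact: linear0.
  by subst m; rewrite transport_id.
have ps (b : A 0) : exists2 t, t \in supp (pword p 0 0) &
    t \in supp (fun w => (size w <= 1)%N) /\ bdry (pev p 0 t - b).
  have [c bE] := eP b (deg0_cocycle _ b).
  pose c0 := \sum_(l < q) c l * aug A 0 (e l).
  exists (\sum_(l < q) c l *: mono [:: (0%N, val l)] + c0 *: mono [::]).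
    rewrite rpredD ?rpredZ ?supp_mono // rpred_sum // => l _.
    by rewrite rpredZ // supp_mono // /pword /okw /= letE ltn_ord.
  split.
    rewrite rpredD ?rpredZ ?supp_mono // rpred_sum // => l _.
    by rewrite rpredZ // supp_mono.
  have valE l : pev p 0 (mono [:: (0%N, l)]) = a l.
    by rewrite [LHS](ev_letter _ (pval p) (0%N, l)) /= transport_id.
  have nilE : pev p 0 (mono [::]) = dunit A.
    by rewrite [LHS]ev_mono; apply: transport_id.
  rewrite linearD linearZ (linear_sum (pev p 0)) /= nilE.
  rewrite -opprB; apply: bdryN; move: bE; congr (bdry (b - _)).
  rewrite /c0 scaler_suml -big_split /=; apply: eq_bigr => l _.
  by rewrite linearZ /= valE /a scalerBr scalerA subrK.
exists p => //; split=> //.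
  by move=> [m l]; rewrite letE => /andP[/eqP -> _].
move=> m; rewrite leqn0 => /eqP -> b _.
have [t tp [_ tb]] := ps b; exists t => //; split=> //.
exact: pder_weight0.
Qed.

(* The relations needed in degree 0 are those among words of length at most 2:
   they rewrite a product of two letters as a combination of shorter words. *)
Lemma stage1_exists : exists p : presentation, stage 1 p.
Proof.
have [p pst p1] := stage0_exists; have [pv pb ps pi] := pst.
have [ws wsP] := finite_words p 0 3.
pose K : {pred FA} := fun z =>
  (z \in kernel p 0) && (z \in supp (fun w => (size w <= 2)%N)).
have Ksub : submod_closed K.
  split=> [|c x y /andP[xK xs] /andP[yK ys]]; apply/andP; split;
    by rewrite ?rpred0 // rpredD ?rpredZ.
pose SK : submodClosed FA := HB.pack K (GRing.isSubmodClosed.Build k FA K Ksub).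
have [zs [zsK zsP]] := subspace_generators SK (fun w => coef FA w) ws.
have [|p' [pv' pb' pp' ps' kz]] := kill fdA pst (zs := zs).
  by move=> z /zsK /andP[].
(* The list [ws] contains every word that can occur in [K], so [zs] spans [K] exactly. *)
have Kkill z : z \in K -> exists2 s, s \in supp (pword p' 0 1) & pder p' s = z.
  move=> zK; have [c cP] := zsP z zK.
  have zE : z = \sum_(l < size zs) c l *: zs`_l.
    set u := z - _ in cP.
    have uK : u \in SK.
      apply: submodB; first exact: zK.
      by apply: rpred_sum => l _; apply/rpredZ/zsK/mem_nth.
    suff : u = 0 by move/eqP; rewrite subr_eq0 => /eqP.
    apply: coefP => w; rewrite linear0; apply/eqP; apply: contraT => uw.
    have /andP[/kernelP[up _ _] us] := uK.
    have /and3P[h1 /eqP h2 _] := suppP _ _ up w uw.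
    have wws : w \in ws by apply: wsP; rewrite ?h2 //;
      apply: (suppP _ _ us w uw).
    move: uw; have -> : coef FA w u = 0; last by rewrite eqxx.
    by elim: cP wws => //= w' s w'0 _ IH; rewrite inE => /orP[/eqP ->|].
  have sP l : exists s', (l < size zs)%N ->
      s' \in supp (pword p' 0 1) /\ pder p' s' = zs`_l.
    have [lz|lz] := ltnP l (size zs); last by exists 0.
    by have [s' s'p ds'] := kz _ (mem_nth 0 lz); exists s'.
  pose sz l := projT1 (cid (sP l)).
  have szP l : (l < size zs)%N ->
      sz l \in supp (pword p' 0 1) /\ pder p' (sz l) = zs`_l.
    by rewrite /sz; case: cid.
  exists (\sum_(l < size zs) c l *: sz l).
    by rewrite rpred_sum // => l _; rewrite rpredZ //; case: (szP l).
  rewrite (linear_sum (pder p')) [RHS]zE; apply: eq_bigr => l _.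
  by rewrite linearZ /=; case: (szP l) => // _ ->.
(* Every element of weight 0 will turn out to be [short]; the reduced form of a kernel element then
   lies in [K], where [Kkill] applies. *)
pose short (t : FA) := exists t', exists s, [/\ t' \in supp (pword p 0 0),
  t' \in supp (fun w => (size w <= 1)%N), s \in supp (pword p' 0 1) &
  t = t' + pder p' s].
have short0 : short 0.
  by exists 0, 0; rewrite !rpred0 linear0 addr0.
have shortD f g : short f -> short g -> short (f + g).
  move=> [t [s [tp ts sp ->]]] [t' [s' [t'p t's s'p ->]]].
  by exists (t + t'), (s + s'); rewrite !rpredD // linearD /= addrACA.
have shortZ c f : short f -> short (c *: f).
  move=> [t [s [tp ts sp ->]]].
  by exists (c *: t), (c *: s); rewrite !rpredZ // linearZ /= scalerDr.
have shortN f : short f -> short (- f) by rewrite -scaleN1r; apply: shortZ.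
have short_word n w : (size w <= n)%N -> pword p 0 0 w -> short (mono w).
  elim: n w => [|n IH] w wn wp.
    exists (mono w), 0; rewrite rpred0 linear0 addr0 supp_mono // supp_mono //.
    by apply: leq_trans wn _.
  case: w wn wp => [|x [|y u]] wn wp.
  - exists (mono [::]), 0; rewrite rpred0 linear0 addr0.
    by rewrite supp_mono // supp_mono.
  - exists (mono [:: x]), 0; rewrite rpred0 linear0 addr0.
    by rewrite supp_mono // supp_mono.
  have [xyp up] : pword p 0 0 [:: x; y] /\ pword p 0 0 u.
    move: wp; rewrite /pword /okw !andbT /= => /andP[/and3P[-> -> ->]].
    by rewrite !wt_cons !addn_eq0 => /and3P[-> -> ->].
  have [t tp [ts tb]] := p1 (pev p 0 (mono [:: x; y])).
  have xyp' := supp_mono FA xyp.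
  have [|s sp ds] := Kkill (t - mono [:: x; y]).
    apply/andP; split.
      apply/kernelP; split; first by rewrite rpredB.
        by rewrite linearB /= !pder_weight0 // subrr.
      by rewrite linearB.
    rewrite rpredB //; last exact: supp_mono.
    by apply: suppS ts => w /leq_trans; apply.
  (* The first two letters are traded for a combination [t] of shorter words, modulo a boundary of
     [p']. *)
  have -> : mono [:: x, y & u] = t * mono u - pder p' (s * mono u).
    have u0 : pder p' (mono u) = 0.
      by apply: pder_weight0 => //; apply: supp_mono;
        apply: agree_pword pp' _ _ _ up.
    rewrite [pder _ _]derM [der _ _ (mono u)]u0 mulr0 addr0 [der _ _ s]ds.
    by rewrite mulrBl subKr -mono_cat.
  have up' : pword p' 0 0 u by apply: agree_pword pp' _ _ _ up.
  apply: (shortD).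
    have : t \in supp (fun w => pword p 0 0 w && (size w <= 1)%N) by apply:
      suppI.
    move: t {tp ts tb ds} => t; move: t.
    apply: supp_ind => [|f g fn gn|c f fn|w /andP[wp' w1]].
    - by rewrite mul0r.
    - by rewrite mulrDl; apply: shortD.
    - by rewrite -scalerAl; apply: shortZ.
    rewrite -mono_cat; apply: IH.
      by rewrite size_cat; apply: leq_trans (leq_add w1 (leqnn _)) _.
    move: wp' up; rewrite /pword /okw !andbT all_cat wt_cat.
    by move=> /andP[-> /eqP ->] /andP[-> /eqP ->].
  apply: shortN; exists 0, (s * mono u).
  rewrite !rpred0 add0r; split=> //.
  apply: suppM sp (supp_mono FA up') =>
    v v' /and3P[vok /eqP v1 _] /and3P[v'ok /eqP v'0 _].
  by rewrite /pword /okw all_cat vok v'ok wt_cat v1 v'0.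
exists p'; split=> // m.
  rewrite leq_eqVlt => /orP[/eqP -> //|m1].
  by apply: agree_psurj pp' _; apply: ps.
rewrite ltnS leqn0 => /eqP -> t tp' _ et.
have tp : t \in supp (pword p 0 0).
  by apply: suppS tp' => w; apply: (agree_pword_inv pp').
have [t' [s [t'p t's sp tE]]] : short t.
  move: t tp {tp' et}; apply: supp_ind => // w wp.
  exact: (short_word _ _ (leqnn (size w))).
have [|s' s'p ds'] := Kkill t'.
  apply/andP; split=> //; last by apply: suppS t's => w /leq_trans; apply.
  apply/kernelP; split=> //; first exact: pder_weight0.
  have -> : t' = t - pder p' s by rewrite tE addrK.
  have t'ok := pword_ok t'p.
  have : bdry (pev p' 0 (t - pder p' s)).
    by rewrite linearB; apply: bdryB => //; apply: pev_pder sp.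
  by rewrite -(agree_pev pp') // tE addrK.
exists (s' + s); first by rewrite rpredD.
by rewrite linearD /= ds' tE.
Qed.

Hypothesis nilA : exists n, forall s : nat -> A 0,
  (forall i, aug A 0 (s i) = 0) -> bdry (iprod s n).

(** Each weight is settled after finitely many stages, so the union of the stages can be read off
    diagonally. *)
Lemma presentation_exists : exists p : presentation,
  [/\ valid p, forall m, psurj p m & forall m, pinj p m].
Proof.
have next n (P : {p : presentation | stage n.+1 p}) :
    exists P' : {p : presentation | stage n.+2 p},
      agree n.+1 (sval P) (sval P').
  case: P => p pst; have [p' p'st pp'] := next_stage fdA nilA pst.
  by exists (exist _ p' p'st).
have [p1 p1st] := stage1_exists.
pose P := fix P n : {p : presentation | stage n.+1 p} :=
  if n is m.+1 then projT1 (cid (next m (P m))) else exist _ p1 p1st.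
pose Q n := sval (P n).
have Qst n : stage n.+1 (Q n) by rewrite /Q; case: (P n).
have QS n : agree n.+1 (Q n) (Q n.+1).
  by rewrite {2}/Q /=; case: cid.
have Qmono m n : (m <= n)%N -> agree m.+1 (Q m) (Q n).
  elim: n => [|n IH]; first by rewrite leqn0 => /eqP ->; apply: agree_refl.
  rewrite leq_eqVlt => /orP[/eqP ->|mn]; first exact: agree_refl.
  exact: agree_trans mn (IH mn) (QS n).
have Qb n x : letter (Q n) x -> (x.1 <= n.+1)%N.
  by case: (Qst n) => _ h _ _; apply: h.
(* Stage [Q m] already has all its letters of weight up to [m.+1], so those of weight [m] are final
   there. *)
pose p : presentation := Presentation (fun m => pcard (Q m) m)
  (fun x => pdiff (Q x.1) x) (fun x => pval (Q x.1) x).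
have letE x : letter p x = letter (Q x.1) x by [].
have Qp n : agree n.+1 (Q n) p.
  split=> [x xQ|x xn].
    rewrite letE /=; have [nx|xn] := leqP n x.1; first exact: (Qmono _ _ nx).1.
    have [h1 h2] := Qmono _ _ (ltnW xn).
    have xQ' := h2 x (leqnSn _) xQ.
    by have [_ -> ->] := h1 x xQ'.
  rewrite letE => xQ; have [xn'|nx] := leqP x.1 n.
    by have [] := (Qmono _ _ xn').1 x xQ.
  have xE : x.1 = n.+1 by apply/eqP; rewrite eqn_leq xn nx.
  by apply: (QS n).2; rewrite xE in xQ *.
have Qv n : valid (Q n) by case: (Qst n).
have Qok x : pdiff p x \in supp (all (letter (Q x.1))) by apply: v_ok.
exists p; split=> [|m|m].
- split=> x.
  + exact: (v_wt (Qv x.1)).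
  + exact: (v_size (Qv x.1)).
  + by apply: (agree_ok (Qp x.1)).
  + by rewrite -(agree_pder (Qp x.1)) //; apply: (v_der (Qv x.1)).
  + by rewrite -(agree_pev (Qp x.1)) //; apply: (v_ev (Qv x.1)).
  + exact: (v_aug (Qv x.1)).
- by apply: agree_psurj (Qp m) _; case: (Qst m) => _ _ h _; apply: h.
- by apply: agree_pinj (Qp m) _ _ => //; case: (Qst m) => _ _ _ h; apply: h.
Qed.

End Resolution.

Lemma local_good (k : fieldType) (A : npDga k) :
  coh_loc_finite A -> local_ring (H0 A) -> good A.
Proof.
move=> fdA locA; split=> //.
have nilA := local_nilpotent (fdA 0) locA.
have [FA] := MalgModel.free_algebra_exists k (nat * nat)%type.
have [p [pv ps pi]] := presentation_exists FA fdA nilA.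
pose T := sf_npDga (v_wt pv) (v_size pv) (v_ok pv) (v_der pv).
have [r rP] := words_bdry nilA pv (pi 0%N).
have [|P [M [q [qlim TM]]]] :=
  sf_limit (v_wt pv) (v_size pv) (v_ok pv) (v_der pv) _ rP.
  move=> n N; have [ws wsP] := finite_words p n N.
  by exists ws => w wok wn wN; apply: wsP; rewrite ?wn.
exists P, M, q; split=> //.
(* The zigzag is A <- T -> completion; what remains is that evaluation T -> A is a
   quasi-isomorphism. *)
apply: rst_trans TM; apply: rst_sym; apply: rst_step.
have Tdeg i (x : T i) : sf_val x \in supp (fun w => wdeg fst w == i).
  by apply: suppS (sf_valP x) => w /andP[].
have phi_linear i : linear (fun x : T i => pev p i (sf_val x)).
  by move=> c x y; rewrite [sf_val _]linearP linearP.
pose phi_fun i : {linear T i -> A i} := mk_linear (phi_linear i).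
have phi1 : phi_fun 0 (dunit T) = dunit A.
  by rewrite /= -(mono_nil FA) [LHS]ev_mono; apply: transport_id.
have phiM i j n (e : i + j = n) (x : T i) (y : T j) :
    phi_fun n (dmul e x y) = dmul e (phi_fun i x) (phi_fun j y).
  exact: evM.
have phid i j (e : i + 1 = j) (x : T i) :
    phi_fun j (dd T e x) = dd A e (phi_fun i x).
  exact: (ev_der (v_wt pv) (v_ev pv)).
have phi_aug i (x : T i) : aug A i (phi_fun i x) = aug T i x.
  exact: (ev_aug (v_aug pv)).
pose phi : dgaHom T A := DgaHom phi1 phiM phid phi_aug.
exists phi; apply: quasi_iso_intro.
- move=> j y yc; have [j_gt0|j_le0] := ltP 0 j.
    exists 0; first exact: linear0.
    by rewrite linear0 (nonpos j_gt0 y) subrr; apply: bdry0.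
  have jE : j = - `|j|%N%:Z by lia.
  move: y yc; rewrite jE => y yc.
  have [t tp [dt et]] := ps _ y yc.
  have tT : t \in supp (deg_word fst (letter p) (- `|j|%N%:Z)).
    by apply: suppS tp => w; apply: okw_deg_word.
  by exists (SfComp tT); first exact: val_inj.
- move=> j x xc bx; have [j_gt0|j_le0] := ltP 0 j.
    by rewrite (nonpos j_gt0 x); apply: bdry0.
  have jE : j = - `|j|%N%:Z by lia.
  move: x xc bx; rewrite jE => x xc bx.
  have xp : sf_val x \in supp (pword p 0 `|j|%N).
    by have := sf_val_okw x; rewrite abszN absz_nat.
  have dx : pder p (sf_val x) = 0 by exact: (congr1 (@sf_val _ _ _ _ _ _) xc).
  have [s sp ds] := pi _ _ xp dx bx.
  have sT : s \in supp (deg_word fst (letter p) (- (`|j|%N.+1)%:Z)).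
    by apply: suppS sp => w; apply: okw_deg_word.
  have e : - (`|j|%N.+1)%:Z + 1 = - `|j|%N%:Z by lia.
  by exists _, e, (SfComp sT : T _); apply: val_inj.
Qed.

Theorem proposition3p7p7 (k : closedFieldType) (hk : [pchar k]%R =i pred0)
    (A : npDga k) :
  good A <-> coh_loc_finite A /\ local_ring (H0 A).
Proof.
split=> [goodA|[fdA locA]]; last exact: local_good.
by split; [case: goodA|apply: good_local].
Qed.
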